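(* Let $P\subset\mathbb{P}^7$ be a fixed plane and let $W_P$ be a generic web of quadrics in $\mathbb{P}^7$ containing $P$ in its base locus. Let $BS(W_P)$ be the base locus of $W_P$ and let $Z'$ be the double cover of $\mathbb{P}^3$ branched along the determinant surface $D_{W_P}$. Then $BS(W_P)$ and $Z'$ are birational varieties.
   Context: Work over $\mathbb{C}$. A web of quadrics in $\mathbb{P}^7$ is a $4$-dimensional linear subspace $W=\langle Q_1,\dots,Q_4\rangle$ of the $36$-dimensional space of quadratic forms on $\mathbb{C}^8$ (identified with symmetric $8\times 8$ matrices); its members are $Q_\lambda=\lambda_1Q_1+\dots+\lambda_4Q_4$, $\lambda\in\mathbb{P}^3$, so $\mathbb{P}^3$ parametrizes the quadrics of $W$. The base locus $BS(W)$ is the common zero set $\{Q_1=\dots=Q_4=0\}\subset\mathbb{P}^7$. The determinant surface is $D_W=\{\lambda\in\mathbb{P}^3\mid \det(\lambda_1Q_1+\dots+\lambda_4Q_4)=0\}$, an octic surface parametrizing the degenerate quadrics of $W$. Webs containing a fixed plane $P$ in the base locus are the $4$-dimensional subspaces of the $30$-dimensional space of quadratic forms vanishing on $P$, parametrized by the Grassmannian $G(4,30)$; ''generic $W_P$'' means $W_P$ lies in a suitable nonempty Zariski open subset of this parameter space. *)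

(* Defs.v *)
From HB Require Import structures.
From mathcomp Require Import all_boot all_algebra.
From mathcomp Require Import complex.
From mathcomp Require Import Rstruct.
From mathcomp Require Import mpoly.
Set Implicit Arguments.
Unset Strict Implicit.
Unset Printing Implicit Defensive.
Import GRing.Theory.
Local Open Scope ring_scope.

Definition C : closedFieldType := complex Rdefinitions.R.

Definition qform (Q : 'M[C]_8) (x : 'I_8 -> C) : C :=
  ((\row_i x i) *m Q *m (\row_i x i)^T) ord0 ord0.

Definition symmetricmx (Q : 'M[C]_8) : Prop := Q^T = Q.

(* The plane P in P^7 is the projectivization of the row space of B
   (a 3 x 8 matrix of rank 3).  Q vanishes on P. *)
Definition vanishes_on_plane (B : 'M[C]_(3, 8)) (Q : 'M[C]_8) : Prop :=
  forall x : 'I_8 -> C, ((\row_i x i) <= B)%MS -> qform Q x = 0.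

(* A 4-tuple of symmetric matrices, each vanishing on the plane: a point of
   the (Stiefel-type) parameter space lying over the space of quadrics
   containing P. *)
Definition quadrics_through_plane (B : 'M[C]_(3, 8)) (Qs : 'I_4 -> 'M[C]_8) : Prop :=
  forall k, symmetricmx (Qs k) /\ vanishes_on_plane B (Qs k).

Definition lin_indep4 (Qs : 'I_4 -> 'M[C]_8) : Prop :=
  forall c : 'I_4 -> C, \sum_k c k *: Qs k = 0 -> forall k, c k = 0.

Definition web_member (Qs : 'I_4 -> 'M[C]_8) (l : 'I_4 -> C) : 'M[C]_8 :=
  \sum_k l k *: Qs k.

Definition nonzero_pt n (x : 'I_n -> C) : Prop := exists i, x i != 0.

(* Affine cone over the base locus BS(W) in P^7. *)
Definition base_locus (Qs : 'I_4 -> 'M[C]_8) (x : 'I_8 -> C) : Prop :=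
  nonzero_pt x /\ forall k, qform (Qs k) x = 0.

(* Weights of the weighted projective space P(1,1,1,1,4) with coordinates
   (lambda_0..lambda_3, w); w is the last coordinate. *)
Definition wZ (j : 'I_5) : nat := if j == ord_max then 4%N else 1%N.
Definition lam (z : 'I_5 -> C) : 'I_4 -> C := fun k => z (lift ord_max k).
Definition wcoord (z : 'I_5 -> C) : C := z ord_max.

(* Affine cone over the double cover Z' of P^3 branched along the octic
   determinant surface D_W : the hypersurface w^2 = det(Q_lambda) in P(1,1,1,1,4). *)
Definition double_cover (Qs : 'I_4 -> 'M[C]_8) (z : 'I_5 -> C) : Prop :=
  nonzero_pt z /\ wcoord z ^+ 2 = \det (web_member Qs (lam z)).

Definition whomog n (w : 'I_n -> nat) (e : nat) (p : {mpoly C[n]}) : Prop :=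
  forall m : 'X_{1..n}, m \in msupp p -> (\sum_i w i * m i)%N = e.

Definition dense_in n (X U : ('I_n -> C) -> Prop) : Prop :=
  forall p : {mpoly C[n]},
    (forall x, X x -> U x -> p.@[x] = 0) -> forall x, X x -> p.@[x] = 0.

(* BS(W) and Z' are birational: there are rational maps
     phi : BS(W) --> Z',  x |-> [f_0(x):..:f_3(x): f_4(x)]   (f_j homogeneous
         of degree wZ j * d),
     psi : Z' --> BS(W), z |-> [h_0(z):..:h_7(z)]  (h_i weighted homogeneous
         of weighted degree e),
   and dense open subsets U = {u <> 0} of BS(W) and V = {v <> 0} of Z'
   (u, v (weighted) homogeneous) such that phi maps U into V, psi maps V
   into U, and psi o phi = id on U, phi o psi = id on V (as maps of
   (weighted) projective points). *)
Definition birational_BS_Z (Qs : 'I_4 -> 'M[C]_8) : Prop :=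
  exists (d e du dv : nat) (f : 'I_5 -> {mpoly C[8]}) (h : 'I_8 -> {mpoly C[5]})
         (u : {mpoly C[8]}) (v : {mpoly C[5]}),
    [/\ (forall j, whomog (fun _ => 1%N) (wZ j * d) (f j)) /\
        (forall i, whomog wZ e (h i)),
        whomog (fun _ => 1%N) du u /\ whomog wZ dv v,
        dense_in (base_locus Qs) (fun x => u.@[x] != 0) /\
        dense_in (double_cover Qs) (fun z => v.@[z] != 0),
        (forall x, base_locus Qs x -> u.@[x] != 0 ->
           let z := fun j => (f j).@[x] in
           [/\ double_cover Qs z, v.@[z] != 0 &
               exists2 c : C, c != 0 & forall i, (h i).@[z] = c * x i]) &
        (forall z, double_cover Qs z -> v.@[z] != 0 ->
           let x := fun i => (h i).@[z] in
           [/\ base_locus Qs x, u.@[x] != 0 &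
               exists2 t : C, t != 0 & forall j, (f j).@[x] = t ^+ wZ j * z j])].

Definition ParIdx : finType := ('I_4 * 'I_8 * 'I_8)%type.
Definition NPar : nat := #|{: ParIdx}|.
Definition coords (Qs : 'I_4 -> 'M[C]_8) : 'I_NPar -> C :=
  fun i => let: (k, a, b) := enum_val i in Qs k a b.

(* Main.v *)
Require Import Defs.
From Stdlib Require Import FunctionalExtensionality.
From HB Require Import structures.
From mathcomp Require Import all_boot all_algebra.
From mathcomp Require Import complex Rstruct.
From mathcomp Require Import ssrcomplements mpoly ring.
Set Implicit Arguments.
Unset Strict Implicit.
Unset Printing Implicit Defensive.
Import GRing.Theory.
Local Open Scope ring_scope.

(** Move the plane to [P = {w = 0}] in coordinates [x = (y, w)] of C^3 x C^5;
    then [Q_k = [[0, A_k], [A_k^T, S_k]]].  The 3-space spanned by [P] and a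
    point [x] of the base locus lies in [Q_l] iff [A_l w = 0]: three linear
    equations in [l], hence in general one [l], given by the maximal minors of
    the matrix [(A_k w)_k].  A smooth quadric [Q_l] of P^7 containing [P] has
    two such 3-spaces, one in each ruling, and they correspond to the two
    square roots of [det Q_l]; this gives [x |-> (l, s)].  Conversely [(l, s)]
    determines [w] as an isotropic vector of the binary form [S_l] on
    [ker A_l], and then [y] is found by Cramer's rule from the equations
    [2 y A_k w + w S_k w = 0].

    What remains is the density of the open set where these maps are inverse
    to each other.  On the double cover it follows by taking norms.  On the
    base locus, complete the four quadrics to eight quadrics in eight
    variables.  For a generic web the polynomial ring is free over the
    polynomials in the eight quadrics, with the squarefree monomials as a
    basis: they generate (an open condition on the web), and they are
    independent because the monomial bases of both sides have the same size in
    each degree.  So multiplication by a polynomial is a matrix depending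
    polynomially on the point of the base, whose eigenvalues are the values of
    the polynomial on the fibre; what vanishes on general fibres vanishes on
    all of them. *)

(** * Polynomials and their values over an algebraically closed field *)

Section PolynomialFunctions.
Variable K : closedFieldType.

(** [muni] only regroups terms by the power of the last variable, so each coefficient of [p] is a
    coefficient of some coefficient of [muni p]. *)
Lemma muni_eq0 n (p : {mpoly K[n.+1]}) : muni p = 0 -> p = 0.
Proof.
move=> p0; apply/mpolyP=> m; rewrite mcoeff0.
have := congr1 (fun q : {poly {mpoly K[n]}} =>
   (q`_(m ord_max))@_[multinom (m (widen_ord (leqnSn n) i)) | i < n]) p0.
rewrite coef0 mcoeff0 muniE coef_sum raddf_sum /=.
have [mp|/memN_msupp_eq0 -> //] := boolP (m \in msupp p).
rewrite (bigD1_seq m) //= ?msupp_uniq // big1.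
  by rewrite coefZ coefXn eqxx mulr1 mcoeffZ mcoeffX eqxx mulr1 addr0.
move=> k /negP km; rewrite coefZ coefXn.
case: eqP => [eqk|_]; last by rewrite mulr0 mcoeff0.
rewrite mulr1 mcoeffZ mcoeffX; case: eqP => [/mnmP eqm|_]; last by rewrite mulr0.
case: km; apply/eqP/mnmP => i.
have [/= j|->] := unliftP ord_max i; last by [].
move=> ->; have := eqm j; rewrite !mnmE.
by have -> : widen_ord (leqnSn n) j = lift ord_max j
  by apply/val_inj; rewrite /= /bump leqNgt ltn_ord.
Qed.

Lemma meval_muni n (p : {mpoly K[n.+1]}) (v : 'I_n -> K) (t : K) :
  (map_poly (meval v) (muni p)).[t] =
  p.@[fun i => if unlift ord_max i is Some j then v j else t].
Proof.
rewrite muniE mevalE rmorph_sum horner_sum; apply: eq_bigr => m _.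
rewrite /= map_polyZ /= map_polyXn hornerZ hornerXn mevalZ mevalX -mulrA.
congr (_ * _); rewrite big_ord_recr /= unlift_none; congr (_ * _).
apply: eq_bigr => i _; rewrite mnmE.
have -> : widen_ord (leqnSn n) i = lift ord_max i
  by apply/val_inj; rewrite /= /bump leqNgt ltn_ord.
by rewrite liftK.
Qed.

(** Induction on the number of variables: choose [v] where the leading coefficient in the last
    variable does not vanish, then a non-root of the resulting univariate polynomial, which exists
    over an algebraically closed field. *)
Lemma meval_neq0 n (p : {mpoly K[n]}) : p != 0 -> exists v, p.@[v] != 0.
Proof.
elim: n p => [|n IHn] p p0.
  exists (fun _ => 0); rewrite (nvar0_mpolyC p) mevalC.
  by apply: contraNneq p0 => p0; rewrite (nvar0_mpolyC p) p0.
have /IHn[v v0] : lead_coef (muni p) != 0.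
  by rewrite lead_coef_eq0; apply: contraNneq p0 => /muni_eq0 ->.
have /closed_nonrootP[t] : map_poly (meval v) (muni p) != 0.
  by rewrite -size_poly_eq0 size_poly_eq0 -lead_coef_eq0 lead_coef_map_eq.
rewrite rootE meval_muni => pt.
by exists (fun i => if unlift ord_max i is Some j then v j else t).
Qed.

Lemma meval_inj n (p : {mpoly K[n]}) : (forall v, p.@[v] = 0) -> p = 0.
Proof.
by move=> p0; apply/eqP/negPn/negP => /meval_neq0[v]; rewrite p0 eqxx.
Qed.

End PolynomialFunctions.

(** * Algebras of functions *)

Section FunctionAlgebra.
Variables (K : comNzRingType) (T : Type).

(** A ring of functions, given by a closed predicate. The instances below are polynomial functions,
    polynomials in a web and a point together, and functions on a double cover; one proof of
    regularity of the maps serves all of them. *)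
Record funalg (P : (T -> K) -> Prop) : Prop := Funalg {
  fa_ext : forall f g, P f -> f =1 g -> P g;
  fa_cst : forall c, P (fun _ => c);
  fa_add : forall f g, P f -> P g -> P (fun t => f t + g t);
  fa_mul : forall f g, P f -> P g -> P (fun t => f t * g t) }.

Variables (P : (T -> K) -> Prop) (fa : funalg P).

Lemma fa_opp f : P f -> P (fun t => - f t).
Proof.
move=> Pf; apply: (fa_ext fa (fa_mul fa (fa_cst fa (-1)) Pf)) => t.
by rewrite mulN1r.
Qed.

Lemma fa_sub f g : P f -> P g -> P (fun t => f t - g t).
Proof. by move=> Pf Pg; apply: (fa_add fa Pf); apply: fa_opp. Qed.

Lemma fa_sum (I : Type) (r : seq I) (A : pred I) (F : I -> T -> K) :
  (forall i, P (F i)) -> P (fun t => \sum_(i <- r | A i) F i t).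
Proof.
move=> PF; elim: r => [|i r IHr].
  by apply: (fa_ext fa (fa_cst fa 0)) => t; rewrite big_nil.
case: (boolP (A i)) => Ai.
  by apply: (fa_ext fa (fa_add fa (PF i) IHr)) => t; rewrite big_cons Ai.
by apply: (fa_ext fa IHr) => t; rewrite big_cons (negbTE Ai).
Qed.

Lemma fa_prod (I : Type) (r : seq I) (A : pred I) (F : I -> T -> K) :
  (forall i, P (F i)) -> P (fun t => \prod_(i <- r | A i) F i t).
Proof.
move=> PF; elim: r => [|i r IHr].
  by apply: (fa_ext fa (fa_cst fa 1)) => t; rewrite big_nil.
case: (boolP (A i)) => Ai.
  by apply: (fa_ext fa (fa_mul fa (PF i) IHr)) => t; rewrite big_cons Ai.
by apply: (fa_ext fa IHr) => t; rewrite big_cons (negbTE Ai).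
Qed.

Lemma fa_exp k f : P f -> P (fun t => f t ^+ k).
Proof.
move=> Pf; apply: (fa_ext fa (fa_prod (index_enum 'I_k) xpredT (fun=> Pf))) => t.
by rewrite prodr_const card_ord.
Qed.

Definition fa_mx m n (M : T -> 'M[K]_(m, n)) := forall i j, P (fun t => M t i j).

Lemma fa_mx_cst m n (M : 'M[K]_(m, n)) : fa_mx (fun _ => M).
Proof. by move=> i j; apply: (fa_cst fa). Qed.

Lemma fa_mxD m n (M N : T -> 'M[K]_(m, n)) :
  fa_mx M -> fa_mx N -> fa_mx (fun t => M t + N t).
Proof.
by move=> PM PN i j; apply: (fa_ext fa (fa_add fa (PM i j) (PN i j))) => t; rewrite mxE.
Qed.

Lemma fa_mxN m n (M : T -> 'M[K]_(m, n)) : fa_mx M -> fa_mx (fun t => - M t).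
Proof. by move=> PM i j; apply: (fa_ext fa (fa_opp (PM i j))) => t; rewrite mxE. Qed.

Lemma fa_mxZ m n f (M : T -> 'M[K]_(m, n)) :
  P f -> fa_mx M -> fa_mx (fun t => f t *: M t).
Proof.
by move=> Pf PM i j; apply: (fa_ext fa (fa_mul fa Pf (PM i j))) => t; rewrite mxE.
Qed.

Lemma fa_mxM m n p (M : T -> 'M[K]_(m, n)) (N : T -> 'M[K]_(n, p)) :
  fa_mx M -> fa_mx N -> fa_mx (fun t => M t *m N t).
Proof.
move=> PM PN i j.
apply: (@fa_ext _ fa (fun t => \sum_k M t i k * N t k j)); last by move=> t; rewrite mxE.
by apply: fa_sum => k; apply: (fa_mul fa).
Qed.

Lemma fa_mx_sum (I : Type) (r : seq I) (A : pred I) m n (F : I -> T -> 'M[K]_(m, n)) :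
  (forall i, fa_mx (F i)) -> fa_mx (fun t => \sum_(i <- r | A i) F i t).
Proof.
move=> PF i j.
apply: (@fa_ext _ fa (fun t => \sum_(k <- r | A k) F k t i j)).
  by apply: fa_sum => k; apply: PF.
by move=> t; rewrite summxE.
Qed.

Lemma fa_mxT m n (M : T -> 'M[K]_(m, n)) : fa_mx M -> fa_mx (fun t => (M t)^T).
Proof. by move=> PM i j; apply: (fa_ext fa (PM j i)) => t; rewrite mxE. Qed.

Lemma fa_lsubmx m1 m2 n1 (M : T -> 'M[K]_(n1, m1 + m2)) :
  fa_mx M -> fa_mx (fun t => lsubmx (M t)).
Proof. by move=> PM i j; apply: (fa_ext fa (PM (i) (lshift m2 j))) => t; rewrite mxE. Qed.

Lemma fa_rsubmx m1 m2 n1 (M : T -> 'M[K]_(n1, m1 + m2)) :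
  fa_mx M -> fa_mx (fun t => rsubmx (M t)).
Proof. by move=> PM i j; apply: (fa_ext fa (PM (i) (rshift m1 j))) => t; rewrite mxE. Qed.

Lemma fa_usubmx m1 m2 n1 (M : T -> 'M[K]_(m1 + m2, n1)) :
  fa_mx M -> fa_mx (fun t => usubmx (M t)).
Proof. by move=> PM i j; apply: (fa_ext fa (PM (lshift m2 i) (j))) => t; rewrite mxE. Qed.

Lemma fa_dsubmx m1 m2 n1 (M : T -> 'M[K]_(m1 + m2, n1)) :
  fa_mx M -> fa_mx (fun t => dsubmx (M t)).
Proof. by move=> PM i j; apply: (fa_ext fa (PM (rshift m1 i) (j))) => t; rewrite mxE. Qed.

Lemma fa_row_mx m n1 n2 (M : T -> 'M[K]_(m, n1)) (N : T -> 'M[K]_(m, n2)) :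
  fa_mx M -> fa_mx N -> fa_mx (fun t => row_mx (M t) (N t)).
Proof.
move=> PM PN i j; rewrite -(splitK j); case: (fintype.split j) => k /=.
  by apply: (fa_ext fa (PM i k)) => t; rewrite row_mxEl.
by apply: (fa_ext fa (PN i k)) => t; rewrite row_mxEr.
Qed.

Lemma fa_col_mx m1 m2 n (M : T -> 'M[K]_(m1, n)) (N : T -> 'M[K]_(m2, n)) :
  fa_mx M -> fa_mx N -> fa_mx (fun t => col_mx (M t) (N t)).
Proof.
move=> PM PN i j; rewrite -(splitK i); case: (fintype.split i) => k /=.
  by apply: (fa_ext fa (PM k j)) => t; rewrite col_mxEu.
by apply: (fa_ext fa (PN k j)) => t; rewrite col_mxEd.
Qed.

Lemma fa_det n (M : T -> 'M[K]_n) : fa_mx M -> P (fun t => \det (M t)).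
Proof.
move=> PM; apply: fa_sum => s; apply: (fa_mul fa); first exact: (fa_cst fa).
exact: fa_prod.
Qed.

Lemma fa_adj n (M : T -> 'M[K]_n) : fa_mx M -> fa_mx (fun t => \adj (M t)).
Proof.
move=> PM i j; apply: (@fa_ext _ fa (fun t => cofactor (M t) j i)); last first.
  by move=> t; rewrite mxE.
apply: (fa_mul fa); first exact: (fa_cst fa).
apply: fa_det => a b.
by apply: (fa_ext fa (PM (lift j a) (lift i b))) => t; rewrite !mxE.
Qed.

Lemma fa_scalar_mx n f : P f -> fa_mx (fun t => (f t)%:M : 'M[K]_n).
Proof.
move=> Pf i j; apply: (@fa_ext _ fa (fun t => f t * (i == j)%:R)).
  by apply: (fa_mul fa) => //; apply: (fa_cst fa).
by move=> t; rewrite mxE mulr_natr.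
Qed.

Lemma fa_matrix m n (F : T -> 'I_m -> 'I_n -> K) :
  (forall i j, P (fun t => F t i j)) -> fa_mx (fun t => \matrix_(i, j) F t i j).
Proof. by move=> PF i j; apply: (fa_ext fa (PF i j)) => t; rewrite mxE. Qed.

End FunctionAlgebra.

(** * Polynomial functions on affine space *)

Section PolynomialAlgebra.
Variable K : closedFieldType.

Definition polyfun n (f : ('I_n -> K) -> K) :=
  exists p : {mpoly K[n]}, forall v, p.@[v] = f v.

Lemma polyfun_funalg n : funalg (@polyfun n).
Proof.
split.
- by move=> f g [p pf] fg; exists p => v; rewrite pf.
- by move=> c; exists c%:MP => v; rewrite mevalC.
- by move=> f g [p pf] [q qg]; exists (p + q) => v; rewrite mevalD pf qg.
- by move=> f g [p pf] [q qg]; exists (p * q) => v; rewrite mevalM pf qg.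
Qed.

Lemma polyfun_coord n i : polyfun (fun v : 'I_n -> K => v i).
Proof. by exists 'X_i => v; rewrite mevalXU. Qed.

Lemma fa_meval T (P : (T -> K) -> Prop) (fa : funalg P) n (p : {mpoly K[n]})
    (c : T -> 'I_n -> K) :
  (forall i, P (fun t => c t i)) -> P (fun t => p.@[c t]).
Proof.
move=> Pc; apply: (fa_ext fa _ (fun t => esym (mevalE (c t) p))).
apply: fa_sum => // m; apply: (fa_mul fa); first exact: (fa_cst fa).
by apply: fa_prod => // i; apply: fa_exp.
Qed.

Lemma polyfun_mul_eq0 n (f g : ('I_n -> K) -> K) v0 :
  polyfun f -> polyfun g -> f v0 != 0 -> (forall v, f v * g v = 0) ->
  forall v, g v = 0.
Proof.
move=> [p pf] [q qg] fv0 fg0 v.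
have : p * q = 0 by apply: meval_inj => w; rewrite mevalM pf qg.
move/eqP; rewrite mulf_eq0 => /orP[] /eqP p0.
  by move: fv0; rewrite -pf p0 meval0 eqxx.
by rewrite -qg p0 meval0.
Qed.

(** Density of the nonempty basic open set [f != 0] in affine space, which rests on the polynomial
    ring being a domain. *)
Lemma generic_eq0 n (f g : ('I_n -> K) -> K) v0 :
  polyfun f -> polyfun g -> f v0 != 0 -> (forall v, f v != 0 -> g v = 0) ->
  forall v, g v = 0.
Proof.
move=> Pf Pg fv0 fg; apply: (polyfun_mul_eq0 Pf Pg fv0) => v.
by have [->|/fg ->] := eqVneq (f v) 0; rewrite ?mul0r ?mulr0.
Qed.

Lemma polyfun_common_neq0 n (f g : ('I_n -> K) -> K) v1 v2 :
  polyfun f -> polyfun g -> f v1 != 0 -> g v2 != 0 ->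
  exists v, f v != 0 /\ g v != 0.
Proof.
move=> [p pf] [q qg] fv1 gv2.
have [v] : exists v, (p * q).@[v] != 0.
  apply: meval_neq0; apply: mulf_neq0.
    by apply: contraNneq fv1 => p0; rewrite -pf p0 meval0.
  by apply: contraNneq gv2 => q0; rewrite -qg q0 meval0.
by rewrite mevalM mulf_eq0 negb_or pf qg => /andP[]; exists v.
Qed.

End PolynomialAlgebra.

(** * The polynomial ring over a system of quadrics *)

Section CommonEigenvector.
Variable K : closedFieldType.

(** [B] is the matrix of [A] restricted to the row space of [V], in the basis [row_base V]; it has
    an eigenvector over a closed field, which [W] carries back. *)
Lemma stable_eigenvector m n (V : 'M[K]_(m, n)) (A : 'M[K]_n) :
  V != 0 -> stablemx V A -> exists a, (V :&: eigenspace A a)%MS != 0.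
Proof.
move=> V0 stV; pose W := row_base V; pose B := W *m A *m pinvmx W.
have WA : B *m W = W *m A.
  by apply: mulmxKpV; rewrite eq_row_base (submx_trans _ stV)// submxMr// eq_row_base.
have rV : (0 < \rank V)%N by rewrite lt0n mxrank_eq0.
have [a ra] : exists a, root (char_poly B) a.
  by apply/closed_rootP; rewrite size_char_poly; case: (\rank V) rV.
have /eigenvalueP[u uB u0] : eigenvalue B a by rewrite eigenvalue_root_char.
exists a; apply: contraNneq u0 => VI0.
have uWV : (u *m W <= V :&: eigenspace A a)%MS.
  rewrite sub_capmx (submx_trans (submxMl _ _)) ?eq_row_base //=.
  by apply/eigenspaceP; rewrite -mulmxA -WA mulmxA uB scalemxAl.
have uW0 : u *m W = 0 by apply/eqP; rewrite -submx0 -VI0.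
by apply/eqP/(row_free_inj (row_base_free V)); rewrite mul0mx.
Qed.

(** Induction on the list: matrices commuting with [A] preserve its eigenspaces, so the search
    continues inside the intersection of one of them with [V]. *)
Lemma stable_common_eigenvector n (As : seq 'M[K]_n) m (V : 'M[K]_(m, n)) :
    V != 0 -> {in As, forall A, stablemx V A} ->
    {in As &, forall A B, A *m B = B *m A} ->
  exists v : 'rV_n, [/\ v != 0, (v <= V)%MS
    & {in As, forall A, exists a, v *m A = a *: v}].
Proof.
elim: As m V => [|A As IHAs] m V V0 stV cA.
  exists (nz_row V); rewrite nz_row_eq0 V0 nz_row_sub; split=> //.
have [|a VA0] := @stable_eigenvector _ _ V A V0; first by rewrite stV ?mem_head.
have [B BA|B C BA CA|v [v0 vV vAs]] := IHAs _ _ VA0.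
- rewrite sub_capmx.
  rewrite (submx_trans (submxMr _ (capmxSl _ _))) ?stV ?inE ?BA ?orbT //=.
  apply/eigenspaceP; rewrite -mulmxA -(cA A B) ?inE ?eqxx ?BA ?orbT // mulmxA.
  by rewrite (eigenspaceP (capmxSr _ _)) scalemxAl.
- by apply: cA; rewrite inE ?BA ?CA orbT.
exists v; split=> //; first exact: submx_trans vV (capmxSl _ _).
move=> B; rewrite inE => /orP[/eqP->|]; last exact: vAs.
by exists a; apply/eigenspaceP/(submx_trans vV)/capmxSr.
Qed.

End CommonEigenvector.

Section LinearExtension.
Variables (R : comNzRingType) (n : nat) (V : lmodType R) (F : 'X_{1..n} -> V).

Definition mlin (p : {mpoly R[n]}) : V := \sum_(m <- msupp p) p@_m *: F m.

Lemma mlinE k p : (msize p <= k)%N ->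
  mlin p = \sum_(m : 'X_{1..n < k}) p@_m *: F m.
Proof.
move=> le_pi; set I : subFinType _ := 'X_{1..n < k}.
rewrite /mlin (big_mksub I) ?msupp_uniq //=; first last.
  by move=> x /msize_mdeg_lt /leq_trans; apply.
rewrite big_rmcond //= => i.
by move/memN_msupp_eq0 ->; rewrite scale0r.
Qed.

Lemma mlin_is_linear : linear mlin.
Proof.
move=> c p q; pose k := maxn (msize (c *: p + q)) (maxn (msize p) (msize q)).
have [k1 k2 k3] : [/\ msize (c *: p + q) <= k, msize p <= k & msize q <= k]%N.
  by rewrite /k !leq_max !leqnn !orbT.
rewrite !(mlinE (k := k)) // scaler_sumr -big_split; apply: eq_bigr => m _ /=.
by rewrite mcoeffD mcoeffZ scalerDl scalerA.
Qed.

HB.instance Definition _ :=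
  GRing.isLinear.Build R {mpoly R[n]} V *:%R mlin mlin_is_linear.

Lemma mlinX m : mlin 'X_[m] = F m.
Proof. by rewrite /mlin msuppX big_seq1 mcoeffX eqxx scale1r. Qed.

End LinearExtension.

(** * Replacing the squares of the variables by quadrics *)

Section Squares.
Variable n : nat.

(** Every exponent is twice [mhalf m] plus the exponent of a squarefree monomial: the polynomial
    ring is free over the squares of the variables, with the squarefree monomials as a basis. *)
Definition mpar (m : 'X_{1..n}) : {ffun 'I_n -> bool} := [ffun i => odd (m i)].
Definition mhalf (m : 'X_{1..n}) : 'X_{1..n} := [multinom (m i)./2 | i < n].
Definition msqf (e : {ffun 'I_n -> bool}) : 'X_{1..n} :=
  [multinom (e i : nat) | i < n].

Lemma mpar_half m : m = (mhalf m *+ 2 + msqf (mpar m))%MM.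
Proof.
by apply/mnmP => i; rewrite !(mnmDE, mulmnE, mnmE) ffunE muln2 addnC odd_double_half.
Qed.

Lemma mpar_double k m : mpar (k *+ 2 + m)%MM = mpar m.
Proof. by apply/ffunP => i; rewrite !ffunE !(mnmDE, mulmnE, mnmE) oddD muln2 odd_double. Qed.

Lemma mhalf_double k m : mhalf (k *+ 2 + m)%MM = (k + mhalf m)%MM.
Proof. by apply/mnmP => i; rewrite !(mnmDE, mulmnE, mnmE) muln2 halfD odd_double doubleK. Qed.

Lemma mpar_sqf e : mpar (msqf e) = e.
Proof. by apply/ffunP => i; rewrite !ffunE !mnmE oddb. Qed.

Lemma mhalf_sqf e : mhalf (msqf e) = 0%MM.
Proof. by apply/mnmP => i; rewrite !mnmE; case: (e i). Qed.

Lemma mdeg_sqf e : (mdeg (msqf e) <= n)%N.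
Proof.
rewrite mdegE (leq_trans (n := \sum_(i < n) 1)) //; last by rewrite sum1_card card_ord.
by apply: leq_sum => i _; rewrite mnmE; case: (e i).
Qed.

Definition bmon d (i : 'I_#|{: 'X_{1..n < d}}|) : 'X_{1..n} := bmnm (enum_val i).

Lemma mdeg_bmon d (i : 'I_#|{: 'X_{1..n < d}}|) : (mdeg (bmon i) < d)%N.
Proof. exact: (valP (enum_val i)). Qed.

Lemma bmonP d m : (mdeg m < d)%N ->
  exists i : 'I_#|{: 'X_{1..n < d}}|, bmon i = m.
Proof.
by move=> md; exists (enum_rank (BMultinom md)); rewrite /bmon enum_rankK.
Qed.

Lemma bmon_inj d : injective (@bmon d).
Proof. by move=> i j /val_inj/enum_val_inj. Qed.

Lemma mpoly_bmonE (R : comNzRingType) d (p : {mpoly R[n]}) : (msize p <= d)%N ->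
  p = \sum_(i : 'I_#|{: 'X_{1..n < d}}|) p@_(bmon i) *: 'X_[bmon i].
Proof.
move=> pd; rewrite {1}(mpolywE pd) (reindex_onto (@enum_val _ _) enum_rank) /=.
  by apply: eq_bigl => i; rewrite enum_valK eqxx.
by move=> i _; rewrite enum_rankK.
Qed.

Variables (R : comNzRingType) (sq : 'I_n -> {mpoly R[n]}).

Definition qmon (k : 'X_{1..n}) : {mpoly R[n]} := \prod_i sq i ^+ k i.
(** [Psi] replaces each [X_i ^+ 2] by [sq i] and keeps squarefree factors. Its bijectivity says that
    the products of a monomial in the [sq i] and a squarefree monomial form a basis of the
    polynomial ring. *)
Definition PsiX m := qmon (mhalf m) * 'X_[msqf (mpar m)].

Fact Psi_key : unit. Proof. exact: tt. Qed.
Definition Psi : {mpoly R[n]} -> {mpoly R[n]} := locked_with Psi_key (mlin PsiX).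

Lemma PsiE p : Psi p = \sum_(m <- msupp p) p@_m *: PsiX m.
Proof. by rewrite /Psi unlock. Qed.

Lemma Psi_is_linear : linear Psi.
Proof. by move=> c p q; rewrite /Psi unlock; apply: mlin_is_linear. Qed.

HB.instance Definition _ := GRing.isLinear.Build R _ _ *:%R Psi Psi_is_linear.

Lemma qmonD k l : qmon (k + l)%MM = qmon k * qmon l.
Proof.
by rewrite /qmon -big_split; apply: eq_bigr => i _; rewrite mnmE exprD.
Qed.

Lemma qmon0 : qmon 0%MM = 1.
Proof. by rewrite /qmon big1 // => i _; rewrite mnmE expr0. Qed.

Lemma PsiX_double k m : PsiX (k *+ 2 + m)%MM = qmon k * PsiX m.
Proof. by rewrite /PsiX mpar_double mhalf_double qmonD mulrA. Qed.

Lemma PsiX_sqf e : PsiX (msqf e) = 'X_[msqf e].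
Proof. by rewrite /PsiX mpar_sqf mhalf_sqf qmon0 mul1r. Qed.

Lemma Psi_X m : Psi 'X_[m] = PsiX m.
Proof. by rewrite /Psi unlock; apply: mlinX. Qed.

Lemma Psi_double k p : Psi ('X_[k *+ 2] * p) = qmon k * Psi p.
Proof.
rewrite (mpolyE p) mulr_sumr !linear_sum mulr_sumr; apply: eq_bigr => m _ /=.
by rewrite -scalerAr -mpolyXD !linearZ /= !Psi_X PsiX_double scalerAr.
Qed.

Lemma Psi_bmonE d p : (msize p <= d)%N ->
  Psi p = \sum_(i : 'I_#|{: 'X_{1..n < d}}|) p@_(bmon i) *: PsiX (bmon i).
Proof.
move=> pd; rewrite {1}(mpoly_bmonE pd) (linear_sum Psi) /=.
by apply: eq_bigr => i _; rewrite linearZ /= Psi_X.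
Qed.

(** Row [i] lists the coefficients, in degrees below [d], of the image under [Psi] of the [i]-th
    monomial. When the [sq i] have degree at most 2, [Psi] does not raise degrees and this is its
    matrix on that space. *)
Definition Hmx d : 'M[R]_#|{: 'X_{1..n < d}}| :=
  \matrix_(i, j) (PsiX (bmon i))@_(bmon j).

End Squares.

(** * Freeness over the quadrics and matrices of multiplication *)

Section SquaresField.
Variable (K : closedFieldType).

Lemma msizeM_leS n (p q : {mpoly K[n]}) a b :
  (msize p <= a.+1)%N -> (msize q <= b.+1)%N -> (msize (p * q) <= (a + b).+1)%N.
Proof.
have [->|p0] := eqVneq p 0; first by rewrite mul0r msize0.
have [->|q0] := eqVneq q 0; first by rewrite mulr0 msize0.
move=> pa qb; rewrite msizeM // -subn1 leq_subLR addSn add0n.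
by rewrite (leq_trans (leq_add pa qb)) // addSn addnS.
Qed.

Lemma msizeXn_le n (p : {mpoly K[n]}) a k :
  (msize p <= a.+1)%N -> (msize (p ^+ k) <= (k * a).+1)%N.
Proof.
move=> pa; elim: k => [|k IHk]; first by rewrite expr0 msize1.
by rewrite exprS mulSn msizeM_leS.
Qed.

Lemma msizeD_leS n (p q : {mpoly K[n]}) d :
  (msize p <= d)%N -> (msize q <= d)%N -> (msize (p + q) <= d)%N.
Proof. by move=> pd qd; rewrite (leq_trans (mmeasureD_le _ _ _)) // geq_max pd. Qed.

Variables (n : nat) (sq : 'I_n -> {mpoly K[n]}).
Hypothesis sq_deg : forall i, (msize (sq i) <= 3)%N.

Lemma msize_qmon (k : 'X_{1..n}) : (msize (qmon sq k) <= (2 * mdeg k).+1)%N.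
Proof.
rewrite mdegE /qmon big_distrr /=.
elim/big_ind2: _ => [|p a q b|i _]; first by rewrite msize1.
  exact: msizeM_leS.
by rewrite mulnC; apply: msizeXn_le.
Qed.

Lemma mdeg_par_half (m : 'X_{1..n}) : (2 * mdeg (mhalf m) + mdeg (msqf (mpar m)))%N = mdeg m.
Proof. by rewrite {3}(mpar_half m) mdegD mdegMn mulnC. Qed.

Lemma msize_PsiX m : (msize (PsiX sq m) <= (mdeg m).+1)%N.
Proof.
by rewrite -(mdeg_par_half m) msizeM_leS ?msize_qmon // msizeX.
Qed.

Hypothesis base : forall m, (mdeg m <= n.+1)%N ->
  exists2 h, (msize h <= (mdeg m).+1)%N & Psi sq h = 'X_[m].

(** The bound [n.+1] in [base] is the largest degree of a variable times a squarefree monomial; the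
    even part of [m] is carried along by [Psi_double]. *)
Lemma Psi_mulX_surj i m :
  exists2 h, (msize h <= (mdeg m).+2)%N & Psi sq h = 'X_i * PsiX sq m.
Proof.
have [|h hd hX] := @base (U_(i) + msqf (mpar m))%MM.
  by rewrite mdegD mdeg1 add1n ltnS mdeg_sqf.
exists ('X_[mhalf m *+ 2] * h).
  rewrite -(mdeg_par_half m) -addnS msizeM_leS ?msizeX ?mdegMn 1?mulnC //.
  by rewrite (leq_trans hd) // mdegD mdeg1.
by rewrite Psi_double hX mpolyXD /PsiX mulrCA.
Qed.

Lemma Psi_mulX_surj_poly i g :
  exists2 h, (msize h <= (msize g).+1)%N & Psi sq h = 'X_i * Psi sq g.
Proof.
suff H s : {subset s <= msupp g} -> exists2 h, (msize h <= (msize g).+1)%N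
    & Psi sq h = \sum_(m <- s) 'X_i * (g@_m *: PsiX sq m).
  by have [//|h hd hE] := H (msupp g); exists h => //; rewrite hE PsiE mulr_sumr.
elim: s => [|m s IHs] sub.
  by exists 0; rewrite ?msize0 ?linear0 ?big_nil.
have [k ks|h hd hE] := IHs; first by apply: sub; rewrite inE ks orbT.
have [h' hd' hE'] := Psi_mulX_surj i m.
exists (g@_m *: h' + h); last by rewrite linearP /= hE hE' big_cons scalerAr.
apply: msizeD_leS => //; rewrite (leq_trans (msizeZ_le _ _)) // (leq_trans hd') //.
by rewrite ltnS msize_mdeg_lt // sub ?mem_head.
Qed.

(** Induction on the degree, removing one variable at a time. The bound on [msize h] prepares the
    dimension count for injectivity. *)
Lemma Psi_surj_mon m :
  exists2 h, (msize h <= (mdeg m).+1)%N & Psi sq h = 'X_[m].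
Proof.
have [d] := ubnP (mdeg m); elim: d m => // d IHd m md.
have [/existsP[i mi]|m0] := boolP [exists i, m i != 0%N]; last first.
  apply: base; suff -> : m = 0%MM by rewrite mdeg0.
  apply/mnmP => i; rewrite mnm0E; apply/eqP/negPn.
  by apply: contraNN m0 => mi; apply/existsP; exists i.
have Em : m = (U_(i) + (m - U_(i)))%MM.
  apply/mnmP => j; rewrite !mnmE; case: eqP => [<-|_].
    by rewrite subnKC // lt0n.
  by rewrite subn0 add0n.
have dm := congr1 (@mdeg n) Em; rewrite mdegD mdeg1 add1n in dm.
have [|g gd gE] := IHd (m - U_(i))%MM; first by rewrite -ltnS -dm.
have [h hd hE] := Psi_mulX_surj_poly i g.
exists h; first by rewrite (leq_trans hd) // dm ltnS.
by rewrite hE gE -mpolyXD -Em.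
Qed.

Lemma Psi_surj p : exists h, Psi sq h == p.
Proof.
elim/mpolyind: p => [|c m p _ _ [h /eqP hE]]; first by exists 0; rewrite linear0.
have [g _ gE] := Psi_surj_mon m.
by exists (c *: g + h); rewrite linearP /= gE hE.
Qed.

(** Preimages of bounded degree give a left inverse [L] of the square matrix [Hmx sq d]. Such an
    inverse is two-sided, so no nonzero row is killed. *)
Lemma Psi_eq0 p : Psi sq p = 0 -> p = 0.
Proof.
move=> p0; pose d := msize p; pose N := #|{: 'X_{1..n < d}}|.
have /fin_all_exists[h hP] (i : 'I_N) :
    exists h, (msize h <= d)%N /\ Psi sq h = 'X_[bmon i].
  have [h hd hE] := Psi_surj_mon (bmon i); exists h; split=> //.
  by rewrite (leq_trans hd) // mdeg_bmon.
pose L : 'M[K]_N := \matrix_(i, j) (h i)@_(bmon j).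
have expand (q : {mpoly K[n]}) (k : 'I_N) : (msize q <= d)%N ->
    \sum_j q@_(bmon j) * Hmx sq d j k = (Psi sq q)@_(bmon k).
  move=> qd; rewrite (Psi_bmonE sq qd) raddf_sum /=.
  by apply: eq_bigr => j _; rewrite mcoeffZ mxE.
have LH : L *m Hmx sq d = 1%:M.
  apply/matrixP => i k; rewrite !mxE.
  under eq_bigr => j _ do rewrite mxE.
  have [hd hE] := hP i; rewrite expand // hE mcoeffX.
  by rewrite (inj_eq (@bmon_inj _ _)).
pose r : 'rV[K]_N := \row_j p@_(bmon j).
have rH : r *m Hmx sq d = 0.
  apply/rowP => k; rewrite !mxE.
  under eq_bigr => j _ do rewrite mxE.
  by rewrite expand // p0 mcoeff0.
have r0 : r = 0 by rewrite -[r]mulmx1 -(mulmx1C LH) mulmxA rH mul0mx.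
rewrite (mpoly_bmonE (leqnn d)) big1 // => i _.
by have /rowP/(_ i) := r0; rewrite !mxE => ->; rewrite scale0r.
Qed.

Lemma Psi_inj : injective (Psi sq).
Proof.
by move=> p q pq; apply/eqP; rewrite -subr_eq0; apply/eqP/Psi_eq0; rewrite linearB /= pq subrr.
Qed.

Fact Psinv_key : unit. Proof. exact: tt. Qed.
Definition Psinv : {mpoly K[n]} -> {mpoly K[n]} :=
  locked_with Psinv_key (fun p => xchoose (Psi_surj p)).

Lemma PsinvK p : Psi sq (Psinv p) = p.
Proof. by rewrite /Psinv unlock; apply/eqP/(xchooseP (Psi_surj p)). Qed.

Lemma PsiK p : Psinv (Psi sq p) = p.
Proof. by apply: Psi_inj; rewrite PsinvK. Qed.

Lemma Psinv_linear : linear Psinv.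
Proof. by move=> c p q; apply: Psi_inj; rewrite linearP /= !PsinvK. Qed.

Let N := #|{: {ffun 'I_n -> bool}}|.

(** [rho s] puts [s i] for [X_i ^+ 2] and reads off coordinates on the squarefree monomials. Hence
    [rho s] after [Psinv] reduces a polynomial modulo the ideal generated by the [sq i - s i], that
    is, on the fibre over [s]. *)
Definition rhoX (s : 'I_n -> K) m : 'rV[K]_N :=
  (\prod_i s i ^+ mhalf m i) *: delta_mx 0 (enum_rank (mpar m)).

Fact rho_key : unit. Proof. exact: tt. Qed.
Definition rho s : {mpoly K[n]} -> 'rV[K]_N := locked_with rho_key (mlin (rhoX s)).

Lemma rho_is_linear s : linear (rho s).
Proof. by move=> c p q; rewrite /rho unlock; apply: mlin_is_linear. Qed.

HB.instance Definition _ s :=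
  GRing.isLinear.Build K _ _ *:%R (rho s) (rho_is_linear s).

Lemma rhoE s p : rho s p = \sum_(m <- msupp p) p@_m *: rhoX s m.
Proof. by rewrite /rho unlock. Qed.

Lemma rho_X s m : rho s 'X_[m] = rhoX s m.
Proof. by rewrite /rho unlock; apply: mlinX. Qed.

Lemma rho_double s k p :
  rho s ('X_[k *+ 2] * p) = (\prod_i s i ^+ k i) *: rho s p.
Proof.
elim/mpolyind: p => [|c m p _ _ IHp]; first by rewrite mulr0 !(linear0 (rho s)) scaler0.
rewrite mulrDr -scalerAr !(linearP (rho s)) /= IHp scalerDr -mpolyXD !rho_X /rhoX.
rewrite mpar_double mhalf_double.
under eq_bigr => i _ do rewrite mnmDE exprD.
by rewrite big_split /= !scalerA mulrCA mulrA.
Qed.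

Fact Gmx_key : unit. Proof. exact: tt. Qed.
(** Matrix, acting on rows, of multiplication by [f] on the coordinate ring of the fibre of [sq]
    over [s], in the basis of squarefree monomials. *)
Definition Gmx (f : {mpoly K[n]}) s : 'M[K]_N :=
  \matrix[Gmx_key]_(i, j) rho s (Psinv (f * 'X_[msqf (enum_val i)])) 0 j.

Lemma row_Gmx f s i : row i (Gmx f s) = rho s (Psinv (f * 'X_[msqf (enum_val i)])).
Proof. by apply/rowP => j; rewrite !mxE. Qed.

Lemma Psinv0 : Psinv 0 = 0.
Proof. by apply: Psi_inj; rewrite PsinvK linear0. Qed.

(** Multiplication by [f] commutes with multiplication by the quadrics, so it is determined by its
    effect on the squarefree monomials, the rows of [Gmx]. *)
Lemma rho_Gmx f s g : rho s (Psinv (f * Psi sq g)) = rho s g *m Gmx f s.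
Proof.
elim/mpolyind: g => [|c m g _ _ IHg].
  by rewrite (linear0 (Psi sq)) mulr0 Psinv0 !(linear0 (rho s)) mul0mx.
rewrite (linearP (Psi sq)) (linearP (rho s)) /= mulrDr -scalerAr.
rewrite Psinv_linear (linearP (rho s)) /= IHg mulmxDl -scalemxAl.
congr (_ *: _ + _); rewrite Psi_X rho_X.
have -> : f * PsiX sq m = Psi sq ('X_[mhalf m *+ 2] * Psinv (f * 'X_[msqf (mpar m)])).
  by rewrite Psi_double PsinvK mulrCA.
rewrite PsiK rho_double /rhoX -scalemxAl; congr (_ *: _).
by rewrite -rowE row_Gmx enum_rankK.
Qed.

Lemma GmxM f g s : Gmx (f * g) s = Gmx g s *m Gmx f s.
Proof.
apply/row_matrixP => i; rewrite row_mul !row_Gmx -rho_Gmx PsinvK mulrA.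
by [].
Qed.

Lemma Gmx_comm f g s : Gmx f s *m Gmx g s = Gmx g s *m Gmx f s.
Proof. by rewrite -!GmxM mulrC. Qed.

(** Evaluation at [x] as a linear form on the squarefree basis. For [x] in the fibre over [s] it is
    an eigenvector of every [Gmx f s], with eigenvalue [f.@[x]]. *)
Definition evx (x : 'I_n -> K) : 'cV[K]_N := \col_i ('X_[msqf (enum_val i)]).@[x].

Lemma rho_evx s x g : (forall i, (sq i).@[x] = s i) ->
  (rho s g *m evx x) 0 0 = (Psi sq g).@[x].
Proof.
move=> xs; elim/mpolyind: g => [|c m g _ _ IHg].
  by rewrite (linear0 (rho s)) (linear0 (Psi sq)) mul0mx mxE meval0.
rewrite (linearP (Psi sq)) (linearP (rho s)) /= mulmxDl -scalemxAl mxE [X in X + _]mxE IHg mevalD mevalZ.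
congr (_ * _ + _); rewrite Psi_X rho_X /rhoX /PsiX mevalM /qmon rmorph_prod /=.
rewrite -scalemxAl mxE -rowE !mxE enum_rankK; congr (_ * _).
by apply: eq_bigr => i _; rewrite rmorphXn /= xs.
Qed.

Lemma Gmx_evx f s x : (forall i, (sq i).@[x] = s i) ->
  Gmx f s *m evx x = f.@[x] *: evx x.
Proof.
move=> xs; apply/row_matrixP => i; rewrite row_mul row_Gmx linearZ /=.
apply/colP => j; rewrite ord1 rho_evx // PsinvK mevalM !mxE.
by [].
Qed.

Lemma evx_neq0 x : evx x != 0.
Proof.
apply/eqP => /colP /(_ (enum_rank [ffun=> false])) /eqP.
rewrite !mxE enum_rankK mevalX big1 ?oner_eq0 // => i _.
by rewrite mnmE ffunE expr0.
Qed.

(** Converse to [Gmx_evx]. The matrices of the variables commute with [Gmx f s], hence share an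
    eigenvector inside its eigenspace, and their eigenvalues are the coordinates of the point
    sought. *)
Lemma Gmx_eigenvalue f s (c : 'cV[K]_N) a : c != 0 -> Gmx f s *m c = a *: c ->
  exists2 x, (forall i, (sq i).@[x] = s i) & f.@[x] = a.
Proof.
move=> c0 fc; pose As := [seq (Gmx 'X_i s)^T | i : 'I_n].
have cE : (c^T <= eigenspace (Gmx f s)^T a)%MS.
  by apply/eigenspaceP; rewrite -trmx_mul fc linearZ.
have V0 : eigenspace (Gmx f s)^T a != 0.
  by apply: contraNneq c0 => V0; move: cE; rewrite V0 submx0 trmx_eq0.
have [||v [v0 vV vAs]] := @stable_common_eigenvector K N As _ _ V0.
- move=> _ /mapP[i _ ->]; apply/eigenspaceP.
  rewrite -mulmxA -trmx_mul Gmx_comm trmx_mul mulmxA scalemxAl.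
  by congr (_ *m _); apply/eigenspaceP/submx_refl.
- move=> _ _ /mapP[i _ ->] /mapP[j _ ->].
  by rewrite -!trmx_mul Gmx_comm.
have /fin_all_exists[x xE] (i : 'I_n) : exists b, Gmx 'X_i s *m v^T = b *: v^T.
  have [|b bE] := vAs (Gmx 'X_i s)^T; first by apply/mapP; exists i; rewrite ?mem_enum.
  by exists b; rewrite -[Gmx _ _]trmxK -trmx_mul bE linearZ.
(* The eigenvector [v] as a linear form on polynomials; [thE] shows it to be a multiple of
   evaluation at [x]. *)
pose th (g : {mpoly K[n]}) : K := (rho s (Psinv g) *m v^T) 0 0.
have thP b g h : th (b *: g + h) = b * th g + th h.
  by rewrite /th Psinv_linear (linearP (rho s)) /= mulmxDl -scalemxAl mxE [X in X + _]mxE.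
have thM g h b : Gmx g s *m v^T = b *: v^T -> th (g * h) = b * th h.
  move=> gE; rewrite /th -{1}(PsinvK h) rho_Gmx -mulmxA gE -scalemxAr.
  by rewrite mxE.
have th0 : th 0 = 0 by rewrite /th Psinv0 (linear0 (rho s)) mul0mx mxE.
have thE g : th g = g.@[x] * th 1.
  elim/mpolyind: g => [|b m g _ _ IHg]; first by rewrite meval0 mul0r.
  rewrite thP IHg mevalD mevalZ mulrDl -mulrA; congr (_ * _ + _).
  have [d] := ubnP (mdeg m); elim: d m => // d IHd m md.
  have [/existsP[i mi]|m0] := boolP [exists i, m i != 0%N]; last first.
    suff -> : m = 0%MM by rewrite mpolyX0 meval1 mul1r.
    apply/mnmP => i; rewrite mnm0E; apply/eqP/negPn.
    by apply: contraNN m0 => mi; apply/existsP; exists i.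
  have Em : m = (U_(i) + (m - U_(i)))%MM.
    apply/mnmP => j; rewrite !mnmE; case: eqP => [<-|_].
      by rewrite subnKC // lt0n.
    by rewrite subn0 add0n.
  have dm := congr1 (@mdeg n) Em; rewrite mdegD mdeg1 add1n in dm.
  rewrite Em mpolyXD (thM _ _ _ (xE i)) IHd; last by rewrite -ltnS -dm.
  by rewrite mevalM mevalXU mulrA.
have vE i : v 0 i = ('X_[msqf (enum_val i)]).@[x] * th 1.
  rewrite -thE /th.
  have -> : 'X_[msqf (enum_val i)] = Psi sq 'X_[msqf (enum_val i)] by rewrite Psi_X PsiX_sqf.
  rewrite PsiK rho_X /rhoX mhalf_sqf big1 => [|j _]; last by rewrite mnm0E expr0.
  by rewrite scale1r mpar_sqf enum_valK -rowE !mxE.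
have th1 : th 1 != 0.
  apply: contraNneq v0 => th1; apply/eqP/rowP => i.
  by rewrite vE th1 mulr0 mxE.
exists x.
  move=> i; apply: (mulIf th1); rewrite -thE /th.
  (* [X_i ^+ 2] is sent by [Psi] to [sq i] and contributes the factor [s i] under [rho s], so
     [th (sq i) = s i * th 1]. *)
  have -> : sq i = Psi sq ('X_[U_(i) *+ 2] * 1).
    rewrite Psi_double -mpolyX0 Psi_X.
    have -> : (0 = msqf [ffun=> false] :> 'X_{1..n})%MM.
      by apply/mnmP => j; rewrite !mnmE ffunE.
    rewrite PsiX_sqf; have -> : msqf [ffun=> false] = 0%MM :> 'X_{1..n}.
      by apply/mnmP => j; rewrite !mnmE ffunE.
    rewrite mpolyX0 mulr1 /qmon (bigD1 i) //= mnm1E eqxx expr1 big1 ?mulr1 // => j ji.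
    by rewrite mnm1E eq_sym (negbTE ji) expr0.
  rewrite PsiK rho_double -scalemxAl mxE (bigD1 i) //= mnm1E eqxx expr1.
  rewrite big1 ?mulr1 => [|j ji]; last by rewrite mnm1E eq_sym (negbTE ji) expr0.
  congr (_ * _).
  have P1 : Psi sq 1 = 1.
    have -> : 1 = 'X_[msqf [ffun=> false]] :> {mpoly K[n]}.
      by rewrite -mpolyX0; congr 'X_[_]; apply/mnmP => j; rewrite !mnmE ffunE.
    by rewrite Psi_X PsiX_sqf.
  by rewrite -{2}P1 PsiK.
have fv : Gmx f s *m v^T = a *: v^T.
  by rewrite -[Gmx _ _]trmxK -trmx_mul (eigenspaceP vV) linearZ.
by apply: (mulIf th1); rewrite -thE -(mulr1 f) (thM _ _ _ fv).
Qed.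

End SquaresField.

(** * Density through norms along the fibres *)

Section Density.
Variables (K : closedFieldType) (n : nat) (sq : 'I_n -> {mpoly K[n]}).
Hypothesis base : forall m, (mdeg m <= n.+1)%N ->
  exists2 h, (msize h <= (mdeg m).+1)%N & Psi sq h = 'X_[m].
Local Notation G := (Gmx base).

(** [Psinv] does not involve [s], which enters only through [rho s], polynomially. *)
Lemma Gmx_polyfun f T (P : (T -> K) -> Prop) (s : T -> 'I_n -> K) : funalg P ->
  (forall i, P (fun t => s t i)) -> fa_mx P (fun t => G f (s t)).
Proof.
move=> fa Ps i j; set q := Psinv base (f * 'X_[msqf (enum_val i)]).
apply: (@fa_ext _ _ _ fa (fun t => \sum_(m <- msupp q) q@_m *
  ((\prod_k s t k ^+ mhalf m k) * (delta_mx 0 (enum_rank (mpar m)) : 'rV[K]__) 0 j))).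
  apply: (fa_sum fa) => m; apply: (fa_mul fa); first exact: (fa_cst fa).
  apply: (fa_mul fa); last exact: (fa_cst fa).
  by apply: (fa_prod fa) => k; apply: (fa_exp fa).
move=> t; rewrite mxE rhoE summxE; apply: eq_bigr => m _.
by rewrite /rhoX !mxE.
Qed.

(** Together with [det_Gmx_intro]: the determinant of [G u s] is the norm of [u] along the fibre,
    nonzero exactly when [u] has no zero there. *)
Lemma det_Gmx_neq0 u s x : \det (G u s) != 0 ->
  (forall i, (sq i).@[x] = s i) -> u.@[x] != 0.
Proof.
move=> Gu xs; apply: contraNneq Gu => ux.
rewrite -det_tr; apply/det0P; exists (evx x)^T; first by rewrite trmx_eq0 evx_neq0.
by rewrite -trmx_mul Gmx_evx // ux scale0r trmx0.
Qed.

Lemma det_Gmx_intro u s :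
  (forall x, (forall i, (sq i).@[x] = s i) -> u.@[x] != 0) -> \det (G u s) != 0.
Proof.
move=> us; apply/negP => /eqP Gu.
have /det0P[v v0 vG] : \det (G u s)^T == 0 by rewrite det_tr Gu.
have [||x xs ux] := @Gmx_eigenvalue K n sq base u s v^T 0.
- by rewrite trmx_eq0.
- by rewrite scale0r -[G u s]trmxK -trmx_mul vG trmx0.
by have := us x xs; rewrite ux eqxx.
Qed.

Lemma Gmx_1 s : G 1 s = 1%:M.
Proof.
apply/row_matrixP => i; rewrite row_Gmx mul1r.
have -> : 'X_[msqf (enum_val i)] = Psi sq 'X_[msqf (enum_val i)].
  by rewrite Psi_X PsiX_sqf.
rewrite PsiK rho_X /rhoX mhalf_sqf big1 => [|j _]; last by rewrite mnm0E expr0.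
by rewrite scale1r mpar_sqf enum_valK rowE mulmx1.
Qed.

Lemma Gmx_lin f g c s : G (f + c *: g) s = G f s + c *: G g s.
Proof.
apply/row_matrixP => i; rewrite raddfD /= linearZ /= !row_Gmx.
rewrite mulrDl -scalerAl addrC Psinv_linear (linearP (rho _)) /=.
by rewrite addrC.
Qed.

(* The polynomial [det (1 - c G)] in [c] has no root, hence is constant. *)
Lemma det_Gmx_1 p s c :
  (forall x, (forall i, (sq i).@[x] = s i) -> p.@[x] = 0) -> \det (G (1 + c *: p) s) = 1.
Proof.
move=> ps.
pose P : {poly K} := \det (1%:M + 'X *: map_mx polyC (G p s)).
have PE d : P.[d] = \det (G (1 + d *: p) s).
  rewrite /P -horner_evalE -det_map_mx; congr (\det _).
  rewrite Gmx_lin Gmx_1; apply/matrixP => i j; rewrite !mxE /=.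
  by rewrite horner_evalE hornerD hornerM hornerX hornerC -[_%:R]polyC_natr hornerC.
have /size_poly1P[a _ PA] : size P == 1%N.
  apply/negPn/negP => /closed_rootP[d]; apply/negP; rewrite rootE PE.
  apply: det_Gmx_intro => x xs.
  by rewrite mevalD mevalZ ps // mulr0 addr0 meval1 oner_eq0.
rewrite -PE; have := PE 0; rewrite scale0r addr0 Gmx_1 det1 PA !hornerC => ->.
by [].
Qed.

(** The fibre over [s0] misses the zeros of [u], so the norm of [u] is not identically zero on the
    line through [s0] and the image of [x0]. On that line the norm of [1 + c *: p] is 1 wherever
    that of [u] is nonzero, hence everywhere, which forbids a zero of [1 + c *: p] at [x0]. *)
Theorem common_zeros_dense (A : pred 'I_n) (u : {mpoly K[n]}) s0 p :
    (forall i, A i -> s0 i = 0) ->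
    (forall x, (forall i, (sq i).@[x] = s0 i) -> u.@[x] != 0) ->
    (forall x, (forall i, A i -> (sq i).@[x] = 0) -> u.@[x] != 0 -> p.@[x] = 0) ->
  forall x, (forall i, A i -> (sq i).@[x] = 0) -> p.@[x] = 0.
Proof.
move=> As0 us0 pu x0 Ax0; apply/eqP/negPn/negP => px0.
(* Chosen so that [1 + c *: p] vanishes at [x0]. *)
pose c := - (p.@[x0])^-1.
pose s1 i := (sq i).@[x0].
(* The line through [s0] (at [t = 0]) and the image of [x0] (at [t = 1]); the coordinates in [A]
   stay zero along it. *)
pose s (t : 'I_1 -> K) i := s0 i + t ord0 * (s1 i - s0 i).
have fa := polyfun_funalg K 1.
have Ps i : polyfun (fun t => s t i).
  apply: (fa_add fa); first exact: (fa_cst fa).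
  by apply: (fa_mul fa); [apply: polyfun_coord | apply: (fa_cst fa)].
have As t i : A i -> s t i = 0.
  by move=> Ai; rewrite /s /s1 Ax0 // As0 // subrr mulr0 addr0.
have /(_ (fun=> 1))/eqP : forall t, \det (G (1 + c *: p) (s t)) - 1 = 0.
apply: (@generic_eq0 K 1 (fun t => \det (G u (s t))) _ (fun=> 0)).
- by apply: (fa_det fa); apply: Gmx_polyfun.
- apply: (fa_sub fa); last exact: (fa_cst fa).
  by apply: (fa_det fa); apply: Gmx_polyfun.
- apply: det_Gmx_intro => x xs; apply: us0 => i.
  by rewrite xs /s mul0r addr0.
- move=> t Gut; apply/eqP; rewrite subr_eq0; apply/eqP; apply: det_Gmx_1 => x xs.
  apply: pu; first by move=> i Ai; rewrite xs As.
  exact: det_Gmx_neq0 Gut xs.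
rewrite subr_eq0 => /eqP G1.
have : (1 + c *: p).@[x0] != 0.
  apply: (@det_Gmx_neq0 _ (s (fun=> 1))); first by rewrite G1 oner_eq0.
  by move=> i; rewrite /s mul1r addrC subrK.
by rewrite mevalD mevalZ meval1 /c mulNr mulVf // subrr eqxx.
Qed.

End Density.

(** * Specialization of coefficients *)

Section Functoriality.
Variables (R S : comNzRingType) (f : {rmorphism R -> S}) (n : nat).
Variable sq : 'I_n -> {mpoly R[n]}.
Local Notation fsq := (fun i => map_mpoly f (sq i)).

Lemma map_PsiX m : map_mpoly f (PsiX sq m) = PsiX fsq m.
Proof.
rewrite /PsiX rmorphM /= map_mpolyX; congr (_ * _).
by rewrite /qmon rmorph_prod; apply: eq_bigr => i _; rewrite rmorphXn.
Qed.

Lemma map_Hmx d : map_mx f (Hmx sq d) = Hmx fsq d.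
Proof. by apply/matrixP => i j; rewrite !mxE -mcoeff_map_mpoly map_PsiX. Qed.

Lemma msize_map_mpoly (p : {mpoly R[n]}) : (msize (map_mpoly f p) <= msize p)%N.
Proof.
rewrite [leqLHS]msizeE; apply/bigmax_leqP_seq => m mp _; apply: msize_mdeg_lt.
move: mp; rewrite !mcoeff_msupp mcoeff_map_mpoly.
by apply: contraNneq => ->; rewrite raddf0.
Qed.

End Functoriality.

Section Inverse.
Variables (K : closedFieldType) (n : nat) (sq : 'I_n -> {mpoly K[n]}).
Hypothesis sq_deg : forall i, (msize (sq i) <= 3)%N.

Lemma Psi_invmx d (r : 'rV[K]_#|{: 'X_{1..n < d}}|) : Hmx sq d \in unitmx ->
  Psi sq (\sum_j (r *m invmx (Hmx sq d)) 0 j *: 'X_[bmon j]) =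
  \sum_j r 0 j *: 'X_[bmon j].
Proof.
move=> uH; set r' := r *m _; have -> : r = r' *m Hmx sq d by rewrite mulmxKV.
rewrite linear_sum.
transitivity (\sum_j \sum_k (r' 0 j * Hmx sq d j k) *: 'X_[bmon k] : {mpoly K[n]}).
  apply: eq_bigr => j _; rewrite linearZ /= Psi_X.
  rewrite (@mpoly_bmonE n K d (PsiX sq (bmon j))); last first.
    by rewrite (leq_trans (msize_PsiX sq_deg _)) // mdeg_bmon.
  by rewrite scaler_sumr; apply: eq_bigr => k _; rewrite scalerA !mxE.
rewrite exchange_big /=; apply: eq_bigr => k _.
by rewrite -scaler_suml mxE.
Qed.

(** Row [i] of the inverse matrix is the preimage of the [i]-th monomial. [Hmx sq d] deals with
    degrees below [d], so degree [n.+1] requires [d = n.+2]. *)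
Lemma Hmx_base m : (forall d, (d <= n.+2)%N -> \det (Hmx sq d) != 0) ->
  (mdeg m <= n.+1)%N -> exists2 h, (msize h <= (mdeg m).+1)%N & Psi sq h = 'X_[m].
Proof.
move=> Hdet mn; have [i im] := bmonP (ltnSn (mdeg m)).
have uH : Hmx sq (mdeg m).+1 \in unitmx by rewrite unitmxE unitfE Hdet.
pose r : 'rV[K]_#|{: 'X_{1..n < (mdeg m).+1}}| := delta_mx 0 i.
exists (\sum_j (r *m invmx (Hmx sq (mdeg m).+1)) 0 j *: 'X_[bmon j]).
  apply: (big_ind (fun q : {mpoly K[n]} => (msize q <= (mdeg m).+1)%N)) => [|a b|j _].
  - by rewrite msize0.
  - exact: msizeD_leS.
  - by rewrite (leq_trans (msizeZ_le _ _)) // msizeX mdeg_bmon.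
rewrite Psi_invmx // (bigD1 i) //= mxE !eqxx scale1r im big1 ?addr0 // => j ji.
by rewrite mxE (negbTE ji) andbF scale0r.
Qed.

End Inverse.

(** * Open conditions on the parameter *)

Section Genericity.
Variables (K : closedFieldType) (M n : nat).
Local Notation R := {mpoly K[M]}.
Variables (sq : 'I_n -> {mpoly R[n]}) (u : {mpoly R[n]}) (s0 : 'I_n -> K).
Local Notation sp a p := (map_mpoly (meval a) p).
Hypothesis sq_deg : forall a i, (msize (sp a (sq i)) <= 3)%N.

Let E := {ffun 'I_n -> bool}.
Let D := (\max_(e : E) msize (u * 'X_[msqf e]))%N.
Let F1 : R := \prod_(d < (maxn D n.+2).+1) \det (Hmx sq d).

Lemma F1_det a d : F1.@[a] != 0 -> (d <= maxn D n.+2)%N ->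
  \det (Hmx (fun i => sp a (sq i)) d) != 0.
Proof.
rewrite /F1 rmorph_prod /= => /prodf_neq0 Fa dD.
by have := Fa (Ordinal (ltnSE dD : d < (maxn D n.+2).+1)%N) isT; rewrite /= -det_map_mx map_Hmx.
Qed.

(** Matrix of multiplication by [u] on the fibre over [s0], with the adjugate of [Hmx] in place of
    its inverse, so that the entries stay polynomial in the parameter; the price is a factor
    [\det (Hmx sq D)]. *)
Let Ghat : 'M[R]_#|{: E}| := \matrix_(i, k)
  \sum_j ((\row_j (u * 'X_[msqf (enum_val i)])@_(bmon j)) *m \adj (Hmx sq D)) 0 j
     * (rhoX s0 (bmon j) 0 k)%:MP.

Lemma Ghat_eval a (base : forall m : 'X_{1..n}, (mdeg m <= n.+1)%N ->
    exists2 h, (msize h <= (mdeg m).+1)%N & Psi (fun i => sp a (sq i)) h = 'X_[m]) :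
  \det (Hmx (fun i => sp a (sq i)) D) != 0 ->
  map_mx (meval a) Ghat = \det (Hmx (fun i => sp a (sq i)) D) *: Gmx base (sp a u) s0.
Proof.
set H := Hmx _ D => Hdet.
have uH : H \in unitmx by rewrite unitmxE unitfE.
apply/row_matrixP => i; rewrite linearZ /= row_Gmx.
set r : 'rV[K]_#|{: 'X_{1..n < D}}| :=
  \row_j (sp a u * 'X_[msqf (enum_val i)])@_(bmon j).
have -> : Psinv base (sp a u * 'X_[msqf (enum_val i)]) =
    \sum_j (r *m invmx H) 0 j *: 'X_[bmon j].
  apply: (Psi_inj base); rewrite PsinvK Psi_invmx //.
  set p := _ * _; have pD : (msize p <= D)%N.
    have -> : p = sp a (u * 'X_[msqf (enum_val i)]) by rewrite rmorphM /= map_mpolyX.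
    by rewrite (leq_trans (msize_map_mpoly _ _)) // (leq_bigmax (enum_val i)).
  by rewrite {1}(mpoly_bmonE pD); apply: eq_bigr => j _; rewrite mxE.
rewrite linear_sum scaler_sumr /=; apply/rowP => k.
rewrite [LHS]mxE [LHS]mxE [X in X.@[a]]mxE rmorph_sum summxE.
apply: eq_bigr => j _; rewrite rmorphM /= mevalC linearZ /= rho_X [RHS]mxE [X in _ = _ * X]mxE mulrA.
congr (_ * _); have -> : \det H * (r *m invmx H) 0 j = (r *m \adj H) 0 j.
  by rewrite /invmx uH -scalemxAr [X in _ * X = _]mxE mulVKf.
rewrite !mxE rmorph_sum; apply: eq_bigr => k' _; rewrite rmorphM /=.
congr (_ * _).
  by rewrite !mxE -mcoeff_map_mpoly rmorphM /= map_mpolyX.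
by rewrite /H -map_Hmx -map_mx_adj [RHS]mxE.
Qed.

(* Invertibility of the finitely many matrices [Hmx] and of multiplication by
   [u] on the fibre over [s0] are open conditions on the parameter. *)
Lemma generic_fibre : exists B, forall a0,
    (forall d, (d <= B)%N -> \det (Hmx (fun i => sp a0 (sq i)) d) != 0) ->
    (forall x, (forall i, (sp a0 (sq i)).@[x] = s0 i) -> (sp a0 u).@[x] != 0) ->
  exists2 F : R, F.@[a0] != 0 & forall a, F.@[a] != 0 ->
    (forall d, (d <= n.+2)%N -> \det (Hmx (fun i => sp a (sq i)) d) != 0) /\
    (forall x, (forall i, (sp a (sq i)).@[x] = s0 i) -> (sp a u).@[x] != 0).
Proof.
exists (maxn D n.+2) => a0 H0 u0; exists (F1 * \det Ghat).
  rewrite mevalM mulf_neq0 //.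
    rewrite /F1 rmorph_prod /=; apply/prodf_neq0 => d _.
    by rewrite -det_map_mx map_Hmx H0 // -ltnS.
  have Hn d : (d <= n.+2)%N -> \det (Hmx (fun i => sp a0 (sq i)) d) != 0.
    by move=> dn; rewrite H0 // leq_max dn orbT.
  have HD : \det (Hmx (fun i => sp a0 (sq i)) D) != 0 by rewrite H0 // leq_maxl.
  rewrite -det_map_mx (@Ghat_eval a0 (fun m => @Hmx_base _ _ _ (sq_deg a0) m Hn)) //.
  by rewrite detZ mulf_neq0 ?expf_neq0 //; apply: det_Gmx_intro.
move=> a; rewrite mevalM mulf_eq0 negb_or => /andP[F1a Ga].
have Hd d : (d <= n.+2)%N -> \det (Hmx (fun i => sp a (sq i)) d) != 0.
  by move=> dn; apply: F1_det => //; rewrite leq_max dn orbT.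
split=> // x xs.
apply: (@det_Gmx_neq0 _ _ _ (fun m => @Hmx_base _ _ _ (sq_deg a) m Hd) _ s0 x) => //.
apply: contraNneq Ga => Gu.
rewrite -det_map_mx (@Ghat_eval a (fun m => @Hmx_base _ _ _ (sq_deg a) m Hd)).
  by rewrite detZ Gu mulr0.
by apply: F1_det => //; rewrite leq_max leqnn.
Qed.

End Genericity.

(** * The rational maps *)

Section Nullmx.
Variables (K : comNzRingType) (p q : nat).
Implicit Type X : 'M[K]_(p, p + q).

(** Cramer's rule without division: the columns lie in the kernel of [X], and span it if the left
    block is invertible. For [q = 1] the entries are the maximal minors up to sign. *)
Definition nullmx X : 'M[K]_(p + q, q) :=
  col_mx (- (\adj (lsubmx X) *m rsubmx X)) (\det (lsubmx X))%:M.

Lemma mul_nullmx X : X *m nullmx X = 0.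
Proof.
rewrite -{1}(hsubmxK X) mul_row_col mulmxN mulmxA mul_mx_adj.
by rewrite mul_scalar_mx mul_mx_scalar addNr.
Qed.

Lemma nullmx_proportional r X (w : 'M[K]_(p + q, r)) : X *m w = 0 ->
  \det (lsubmx X) *: w = nullmx X *m dsubmx w.
Proof.
rewrite -{1}(hsubmxK X) -{1}(vsubmxK w) mul_row_col => Xw.
rewrite mul_col_mx mul_scalar_mx -{1}(vsubmxK w) scale_col_mx; congr col_mx.
rewrite mulNmx -mulmxA -mul_scalar_mx -mul_adj_mx -mulmxA.
by apply/eqP; rewrite -addr_eq0 -mulmxDr Xw mulmx0.
Qed.

Lemma dsubmx_nullmx r X (a : 'M[K]_(q, r)) :
  dsubmx (nullmx X *m a) = \det (lsubmx X) *: a.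
Proof. by rewrite mul_col_mx col_mxKd mul_scalar_mx. Qed.


(* Congruence by [Gw], whose last columns are [nullmx X], reduces the bordered
   matrix to an anti-triangular one. *)
Lemma det_bordered X (S : 'M[K]_(p + q)) :
  \det (lsubmx X) ^+ q * \det (lsubmx X) ^+ q * \det (block_mx 0 X X^T S) =
  (-1) ^+ p * \det (lsubmx X) ^+ 2 * \det ((nullmx X)^T *m S *m nullmx X).
Proof.
set L := lsubmx X; set c := \det L; set N := nullmx X.
pose U : 'M[K]_(p + q, p) := col_mx 1%:M 0.
pose Gw : 'M[K]_(p + q) := row_mx U N.
have detGw : \det Gw = c ^+ q.
  by rewrite /Gw /U /N /nullmx -block_mxEh det_ublock det1 mul1r det_scalar.
have XG : X *m Gw = row_mx L 0.
  rewrite mul_mx_row mul_nullmx -{1}(hsubmxK X) mul_row_col.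
  by rewrite mulmx1 mulmx0 addr0.
have SG : Gw^T *m S *m Gw =
    block_mx (U^T *m S *m U) (U^T *m S *m N) (N^T *m S *m U) (N^T *m S *m N).
  by rewrite tr_row_mx mul_col_mx mul_col_mx !mul_mx_row block_mxEv.
pose G : 'M[K]_(p + (p + q)) := block_mx 1%:M 0 0 Gw.
have detG : \det G = c ^+ q by rewrite det_ublock det1 mul1r.
(* [Y] is a product of three shears, hence of determinant 1; it exchanges, up to sign, the first
   block of columns with the first [p] columns of the second. *)
pose Y1 : 'M[K]_(p + (p + q)) := block_mx 1%:M (row_mx 1%:M 0) 0 1%:M.
pose Y2 : 'M[K]_(p + (p + q)) := block_mx 1%:M 0 (- col_mx 1%:M 0) 1%:M.
pose Y := Y1 *m Y2 *m Y1.
have detY : \det Y = 1.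
  by rewrite !det_mulmx !det_ublock det_lblock !det1 !mulr1.
have YE : Y = block_mx 0 (row_mx 1%:M 0) (- col_mx 1%:M 0) (block_mx 0 0 0 1%:M).
  rewrite /Y /Y1 /Y2 !mulmx_block.
  rewrite ?(mulmx1, mul1mx, mulmx0, mul0mx, addr0, add0r).
  rewrite mulmxN mul_row_col mulmx1 mulmx0 addr0 subrr mul0mx add0r.
  congr block_mx; rewrite mulNmx mul_col_row mulmx1 mulmx0 !mul0mx.
  rewrite -[X in _ + X](@submxK _ p q p q) scalar_mx_block.
  by rewrite opp_block_mx block_mxKul block_mxKur block_mxKdl block_mxKdr
    add_block_mx addNr !oppr0 !add0r.
have -> : c ^+ q * c ^+ q * \det (block_mx 0 X X^T S) =
    \det (G^T *m block_mx 0 X X^T S *m G *m Y).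
  by rewrite det_mulmx detY !det_mulmx det_tr detG; ring.
have -> : G^T *m block_mx 0 X X^T S *m G =
    block_mx 0 (row_mx L 0) (col_mx L^T 0)
     (block_mx (U^T *m S *m U) (U^T *m S *m N) (N^T *m S *m U) (N^T *m S *m N)).
  rewrite /G tr_block_mx !trmx0 trmx1 !mulmx_block.
  rewrite ?(mulmx1, mul1mx, mulmx0, mul0mx, addr0, add0r).
  by rewrite XG -SG -trmx_mul XG tr_row_mx trmx0.
have -> : block_mx 0 (row_mx L 0) (col_mx L^T 0)
     (block_mx (U^T *m S *m U) (U^T *m S *m N) (N^T *m S *m U) (N^T *m S *m N)) *m Y =
   block_mx (- L) 0 (- col_mx (U^T *m S *m U) (N^T *m S *m U))
     (block_mx L^T (U^T *m S *m N) 0 (N^T *m S *m N)).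
  rewrite YE !mulmx_block.
  rewrite ?(mulmx1, mul1mx, mulmx0, mul0mx, addr0, add0r).
  rewrite ?(mulmxN, mul_row_col, mul_row_block, mul_block_col, mul_col_row, mulmx_block).
  by rewrite row_mx0 !(mulmx1, mulmx0, mul0mx) add_block_mx !(addr0, add0r).
rewrite det_lblock det_ublock det_tr.
by rewrite -scaleN1r detZ -/c; ring.
Qed.

End Nullmx.

(** * The maps and their homogeneity *)

Section Maps.
Variable K : fieldType.

Lemma sum2E (F : 'I_2 -> K) : \sum_i F i = F 0 + F 1.
Proof. by rewrite big_ord_recl big_ord1; congr (_ + F _); apply: val_inj. Qed.

Lemma ord2P (P : 'I_2 -> Prop) : P 0 -> P 1 -> forall i, P i.
Proof.
move=> P0 P1 [[|[|//]] i]; [rewrite (_ : Ordinal i = 0) //|rewrite (_ : Ordinal i = 1) //];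
  exact: val_inj.
Qed.

Lemma det2E (X : 'M[K]_2) : \det X = X 0 0 * X 1 1 - X 0 1 * X 1 0.
Proof.
have l01 : lift (0 : 'I_2) (0 : 'I_1) = 1 by apply: val_inj.
have l10 : lift (1 : 'I_2) (0 : 'I_1) = 0 by apply: val_inj.
rewrite (expand_det_row X 0) sum2E /cofactor !det_mx11 !mxE /= l01 l10.
by rewrite expr0 expr1 mul1r mulN1r mulrN.
Qed.

Lemma quad2E (X : 'M[K]_2) (a : 'cV[K]_2) : (a^T *m X *m a) 0 0 =
  X 0 0 * a 0 0 ^+ 2 + (X 0 1 + X 1 0) * a 0 0 * a 1 0 + X 1 1 * a 1 0 ^+ 2.
Proof. by rewrite !mxE sum2E !mxE !sum2E !mxE; ring. Qed.

Variables (A : 'I_4 -> 'M[K]_(3, 5)) (S : 'I_4 -> 'M[K]_5).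

Definition lcomb m n (Q : 'I_4 -> 'M[K]_(m, n)) (l : 'cV[K]_4) : 'M[K]_(m, n) :=
  \sum_k l k 0 *: Q k.
(* [l] is a point of the web and [s] a square root of [det Q_l].  [NN l] spans
   the kernel of [A_l], and [al], [be], [ga] are the entries of the Gram matrix
   [TT l] of [S_l] on it; [wz l s] is an isotropic vector of that binary form.
   [l0 w] is the vector of maximal minors of [(A_k w)_k], and [xz w] the point
   of the base locus over [w].  In [(lphi, sphi)] the factor [kap] clears the
   denominator of the square root [(al w4 + be w5) / (cc w5)] of [det Q_l].
   The birational maps are defined where [ufun] and [vfun] do not vanish. *)
Definition Al l : 'M[K]_(3, 3 + 2) := lcomb A l.
Definition cc l := \det (lsubmx (Al l)).
Definition NN l : 'M[K]_(3 + 2, 2) := nullmx (Al l).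
Definition TT l : 'M[K]_2 := (NN l)^T *m lcomb S l *m NN l.
Definition al l := TT l 0 0.
Definition be l := TT l 0 1.
Definition ga l := TT l 1 1.
Definition abv l s : 'cV[K]_2 := \col_i (if i == 0 then cc l * s - be l else al l).
Definition wz l s : 'cV[K]_(3 + 2) := NN l *m abv l s.
Definition M4 (w : 'cV[K]_5) : 'M[K]_(3, 3 + 1) := \matrix_(i, k) (A k *m w) i 0.
Definition mm w := \det (lsubmx (M4 w)).
Definition l0 w : 'cV[K]_(3 + 1) := nullmx (M4 w).
Definition sv (w : 'cV[K]_5) : 'cV[K]_(3 + 1) := \col_k (w^T *m S k *m w) 0 0.
Definition yz w : 'cV[K]_3 := - ((\adj (lsubmx (M4 w)))^T *m usubmx (sv w)).
Definition xz w : 'cV[K]_(3 + 5) := col_mx (yz w) ((2%:R * mm w) *: w).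
Definition w4 (w : 'cV[K]_(3 + 2)) := dsubmx w 0 0.
Definition w5 (w : 'cV[K]_(3 + 2)) := dsubmx w 1 0.
Definition kap w := cc (l0 w) * w5 w.
Definition lphi w := kap w *: l0 w.
Definition sphi w := kap w ^+ 3 * (al (l0 w) * w4 w + be (l0 w) * w5 w).
Definition ufun w := mm w * w5 w * cc (l0 w) * al (l0 w).
Definition vfun l s := cc l * al l * l ord_max 0 * mm (wz l s).
Definition Ql l : 'M[K]_(3 + 5) := block_mx 0 (Al l) (Al l)^T (lcomb S l).

Lemma lcombZ m n (Q : 'I_4 -> 'M[K]_(m, n)) t l : lcomb Q (t *: l) = t *: lcomb Q l.
Proof. by rewrite /lcomb scaler_sumr; apply: eq_bigr => k _; rewrite mxE scalerA. Qed.

Lemma nullmx3Z q t (X : 'M[K]_(3, 3 + q)) : nullmx (t *: X) = t ^+ 3 *: nullmx X.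
Proof.
rewrite /nullmx; have -> : lsubmx (t *: X) = t *: lsubmx X by exact: linearZ.
have -> : rsubmx (t *: X) = t *: rsubmx X by exact: linearZ.
rewrite scale_col_mx adjZ detZ scale_scalar_mx; congr col_mx.
by rewrite -scalemxAl -scalemxAr scalerA scalerN -exprSr.
Qed.

Lemma ccZ t l : cc (t *: l) = t ^+ 3 * cc l.
Proof. by rewrite /cc /Al lcombZ linearZ detZ. Qed.

Lemma NNZ t l : NN (t *: l) = t ^+ 3 *: NN l.
Proof. by rewrite /NN /Al lcombZ nullmx3Z. Qed.

Lemma TTZ t l : TT (t *: l) = t ^+ 7 *: TT l.
Proof.
rewrite /TT NNZ lcombZ [(_ *: _)^T]linearZ /= -scalemxAr -!scalemxAl -scalemxAr -scalemxAl !scalerA.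
by congr (_ *: _); ring.
Qed.

Lemma alZ t l : al (t *: l) = t ^+ 7 * al l. Proof. by rewrite /al TTZ mxE. Qed.
Lemma beZ t l : be (t *: l) = t ^+ 7 * be l. Proof. by rewrite /be TTZ mxE. Qed.

(** Homogeneity for the weights of the double cover, where [s] has weight 4: both [cc l * s] and
    [be l] have degree 7, and [NN] adds 3. *)
Lemma wzZ t l s : wz (t *: l) (t ^+ 4 * s) = t ^+ 10 *: wz l s.
Proof.
rewrite /wz NNZ -scalemxAl.
have -> : abv (t *: l) (t ^+ 4 * s) = t ^+ 7 *: abv l s.
  apply/colP => i; rewrite !mxE ccZ alZ beZ.
  by case: ifP => _ //; ring.
by rewrite -scalemxAr scalerA -exprD.
Qed.

Lemma M4Z t w : M4 (t *: w) = t *: M4 w.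
Proof.
by apply/matrixP => i k; rewrite [LHS]mxE -scalemxAr mxE [RHS]mxE [in RHS]mxE.
Qed.

Lemma mmZ t w : mm (t *: w) = t ^+ 3 * mm w.
Proof. by rewrite /mm M4Z linearZ detZ. Qed.

Lemma l0Z t w : l0 (t *: w) = t ^+ 3 *: l0 w.
Proof. by rewrite /l0 M4Z nullmx3Z. Qed.

Lemma svZ t w : sv (t *: w) = t ^+ 2 *: sv w.
Proof.
apply/colP => k; rewrite [LHS]mxE [RHS]mxE [in RHS]mxE.
by rewrite [(_ *: _)^T]linearZ /= -scalemxAr -!scalemxAl scalerA mxE expr2.
Qed.

Lemma yzZ t w : yz (t *: w) = t ^+ 4 *: yz w.
Proof.
rewrite /yz M4Z svZ [lsubmx (_ *: _)]linearZ /= adjZ [(_ *: _)^T]linearZ /=.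
rewrite [usubmx (_ *: _)]linearZ /= -scalemxAl -scalemxAr.
by rewrite scalerN scalerA -exprD.
Qed.

Lemma xzZ t w : xz (t *: w) = t ^+ 4 *: xz w.
Proof.
rewrite /xz scale_col_mx yzZ mmZ !scalerA; congr (col_mx _ (_ *: _)).
by ring.
Qed.

Lemma w4Z t w : w4 (t *: w) = t * w4 w. Proof. by rewrite /w4 linearZ mxE. Qed.
Lemma w5Z t w : w5 (t *: w) = t * w5 w. Proof. by rewrite /w5 linearZ mxE. Qed.

Lemma kapZ t w : kap (t *: w) = t ^+ 10 * kap w.
Proof. by rewrite /kap l0Z ccZ w5Z; ring. Qed.

Lemma lphiZ t w : lphi (t *: w) = t ^+ 13 *: lphi w.
Proof. by rewrite /lphi kapZ l0Z !scalerA; congr (_ *: _); ring. Qed.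

Lemma sphiZ t w : sphi (t *: w) = t ^+ 52 * sphi w.
Proof. by rewrite /sphi kapZ l0Z alZ beZ w4Z w5Z; ring. Qed.

Lemma ufunZ t w : ufun (t *: w) = t ^+ 34 * ufun w.
Proof. by rewrite /ufun mmZ w5Z l0Z ccZ alZ; ring. Qed.

Lemma vfunZ t l s : vfun (t *: l) (t ^+ 4 * s) = t ^+ 41 * vfun l s.
Proof. by rewrite /vfun ccZ alZ wzZ mmZ mxE; ring. Qed.

Lemma QlZ t l : \det (Ql (t *: l)) = t ^+ 8 * \det (Ql l).
Proof.
have -> : Ql (t *: l) = t *: Ql l.
  by rewrite /Ql scale_block_mx scaler0 /Al !lcombZ [(_ *: _)^T]linearZ.
by rewrite detZ.
Qed.

(** Both sides are [\sum_k l k 0 *: (A k *m w)]: the condition [Al l *m w = 0] is linear in [l], and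
    [l0 w] solves it. *)
Lemma M4_mul w l : M4 w *m l = Al l *m w.
Proof.
apply/colP => i; rewrite /Al /lcomb mulmx_suml summxE [LHS]mxE.
by apply: eq_bigr => k _; rewrite -scalemxAl [RHS]mxE [M4 w i k]mxE mulrC.
Qed.

Lemma Al_l0 w : Al (l0 w) *m w = 0.
Proof. by rewrite -M4_mul mul_nullmx. Qed.

Lemma sv_mul w l : ((l : 'cV_(3 + 1))^T *m sv w) 0 0 = (w^T *m lcomb S l *m w) 0 0.
Proof.
rewrite /lcomb mulmx_sumr mulmx_suml summxE [LHS]mxE.
apply: eq_bigr => k _; rewrite -scalemxAr -scalemxAl [RHS]mxE.
by rewrite [sv w k 0]mxE [_^T 0 k]mxE.
Qed.

Hypothesis Ssym : forall k, (S k)^T = S k.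

Lemma lcomb_sym l : (lcomb S l)^T = lcomb S l.
Proof. by rewrite /lcomb linear_sum; apply: eq_bigr => k _; rewrite linearZ /= Ssym. Qed.

Lemma TT_sym l : TT l 1 0 = be l.
Proof.
have TTs : (TT l)^T = TT l by rewrite /TT !trmx_mul trmxK lcomb_sym mulmxA.
by rewrite /be -{1}TTs mxE.
Qed.

(** Case [p = 3], [q = 2] of [det_bordered]: up to the square of [cc l], the determinant of [Q_l] is
    minus that of the binary form [TT l], so its square roots correspond to the isotropic lines of
    that form. *)
Lemma det_Ql l : cc l != 0 -> cc l ^+ 2 * \det (Ql l) = be l ^+ 2 - al l * ga l.
Proof.
move=> c0; have := det_bordered (Al l) (lcomb S l).
rewrite -/(cc l) -/(NN l) -/(TT l) det2E TT_sym -/(al l) -/(be l) -/(ga l) -/(Ql l) => E.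
apply: (mulfI (expf_neq0 2 c0)); rewrite mulrA E; ring.
Qed.

Lemma quad_NN l (a : 'cV[K]_2) : ((NN l *m a)^T *m lcomb S l *m (NN l *m a)) 0 0 =
  al l * a 0 0 ^+ 2 + 2%:R * be l * a 0 0 * a 1 0 + ga l * a 1 0 ^+ 2.
Proof.
have -> : (NN l *m a)^T *m lcomb S l *m (NN l *m a) = a^T *m TT l *m a.
  by rewrite /TT trmx_mul !mulmxA.
by rewrite quad2E TT_sym -/(al l) -/(be l) -/(ga l); ring.
Qed.

Lemma kernel_NN l w : Al l *m w = 0 -> cc l *: w = NN l *m dsubmx (w : 'cV_(3 + 2)).
Proof. exact: nullmx_proportional. Qed.

End Maps.

(** * The two maps are inverse to each other *)

Section Spec.
Variable K : fieldType.
Hypothesis two0 : 2%:R != 0 :> K.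
Variables (A : 'I_4 -> 'M[K]_(3, 5)) (S : 'I_4 -> 'M[K]_5).
Hypothesis Ssym : forall k, (S k)^T = S k.

Lemma mul_last_row p (l V : 'cV[K]_(p + 1)) : usubmx V = 0 -> l^T *m V = 0 ->
  dsubmx l 0 0 * dsubmx V 0 0 = 0.
Proof.
move=> V1 /matrixP/(_ 0 0); rewrite -{1}(vsubmxK V) V1 -{1}(vsubmxK l).
rewrite tr_col_mx mul_row_col mulmx0 add0r [LHS]mxE [RHS]mxE big_ord1.
by rewrite [_^T _ _]mxE.
Qed.

Definition on_base (y : 'cV[K]_3) (w : 'cV[K]_5) :=
  (M4 A w)^T *m (2%:R *: y) + sv S w = 0.

Lemma l0_last w : l0 A w ord_max 0 = mm A w.
Proof.
have -> : ord_max = rshift 3 (0 : 'I_1) by apply: val_inj.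
by rewrite /l0 /nullmx col_mxEd mxE mulr1n.
Qed.

(** Combining the four equations with the coefficients [l0 A w] removes [y], since
    [M4 A w *m l0 A w = 0]. *)
Lemma on_base_quad y w : on_base y w -> (w^T *m lcomb S (l0 A w) *m w) 0 0 = 0.
Proof.
rewrite /on_base addrC => /eqP; rewrite addr_eq0 => /eqP E.
by rewrite -sv_mul E mulmxN mulmxA -trmx_mul mul_nullmx trmx0 mul0mx oppr0 mxE.
Qed.

Lemma quad_coord l w : cc A l != 0 -> Al A l *m w = 0 ->
  (w^T *m lcomb S l *m w) 0 0 = 0 ->
  al A S l * w4 w ^+ 2 + 2%:R * be A S l * w4 w * w5 w + ga A S l * w5 w ^+ 2 = 0.
Proof.
move=> c0 Aw wSw; rewrite -(quad_NN A Ssym) -kernel_NN //.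
by rewrite [(_ *: _)^T]linearZ /= -scalemxAr -!scalemxAl scalerA mxE wSw mulr0.
Qed.

(** Completing the square in the equation of [quad_coord]: a zero [(w4, w5)] of the binary form
    yields a square root of minus its determinant, with denominator [w5]. *)
Lemma det_point l w : cc A l != 0 -> Al A l *m w = 0 ->
  (w^T *m lcomb S l *m w) 0 0 = 0 ->
  (al A S l * w4 w + be A S l * w5 w) ^+ 2 = (cc A l * w5 w) ^+ 2 * \det (Ql A S l).
Proof.
move=> c0 Aw wSw; have E := quad_coord c0 Aw wSw.
rewrite exprMn mulrAC det_Ql //.
transitivity (al A S l * (al A S l * w4 w ^+ 2 + 2%:R * be A S l * w4 w * w5 w
   + ga A S l * w5 w ^+ 2) + (be A S l ^+ 2 - al A S l * ga A S l) * w5 w ^+ 2).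
  by ring.
by rewrite E; ring.
Qed.

Lemma ufun_neq0 w : ufun A S w != 0 ->
  [/\ mm A w != 0, w5 w != 0, cc A (l0 A w) != 0 & al A S (l0 A w) != 0].
Proof. by rewrite /ufun !mulf_eq0 !negb_or => /andP[/andP[/andP[-> ->] ->] ->]. Qed.

Lemma kap_neq0 w : ufun A S w != 0 -> kap A w != 0.
Proof. by case/ufun_neq0 => _ w50 c0 _; rewrite mulf_neq0. Qed.

Lemma phi_on_cover y w : on_base y w -> ufun A S w != 0 ->
  sphi A S w ^+ 2 = \det (Ql A S (lphi A w)).
Proof.
move=> yw u0; have [m0 w50 c0 a0] := ufun_neq0 u0.
have E := det_point c0 (Al_l0 A w) (on_base_quad yw).
by rewrite /sphi /lphi QlZ exprMn E /kap; ring.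
Qed.

Lemma wz_phi w : ufun A S w != 0 -> exists2 r, r != 0 & 
  wz A S (lphi A w) (sphi A S w) = r *: w.
Proof.
move=> u0; have [m0 w50 c0 a0] := ufun_neq0 u0; have k0 := kap_neq0 u0.
exists (kap A w ^+ 10 * (al A S (l0 A w) / w5 w * cc A (l0 A w))).
  by rewrite !mulf_neq0 ?expf_neq0 ?invr_eq0.
set X := al A S (l0 A w) * w4 w + be A S (l0 A w) * w5 w.
have -> : sphi A S w = kap A w ^+ 4 * (X / kap A w).
  by rewrite /sphi -/X; field.
rewrite wzZ -[RHS]scalerA; congr (_ *: _); rewrite /wz.
(* With [s = X / kap] the entry [cc * s - be] becomes [al * w4 / w5], so the isotropic vector found
   is the original one up to scaling. *)
have -> : abv A S (l0 A w) (X / kap A w) =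
    (al A S (l0 A w) / w5 w) *: dsubmx (w : 'cV_(3 + 2)).
  apply/colP; apply: ord2P; rewrite [LHS]mxE [RHS]mxE /=.
    by rewrite -/(w4 w) /X /kap; field; rewrite c0 w50.
  by rewrite -/(w5 w) divfK.
by rewrite -scalemxAr -kernel_NN ?Al_l0 // scalerA.
Qed.

Lemma yz_base y w : on_base y w -> yz A S w = (2%:R * mm A w) *: y.
Proof.
rewrite /on_base addrC => /eqP; rewrite addr_eq0 => /eqP E.
rewrite /yz E [usubmx _]linearN /= mulmxN opprK.
have -> : usubmx ((M4 A w)^T *m (2%:R *: y)) = (lsubmx (M4 A w))^T *m (2%:R *: y).
  by rewrite -{1}(hsubmxK (M4 A w)) tr_row_mx mul_col_mx col_mxKu.
rewrite mulmxA -trmx_mul mul_mx_adj tr_scalar_mx mul_scalar_mx scalerA.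
by rewrite mulrC.
Qed.

Lemma xz_phi y w : on_base y w -> ufun A S w != 0 -> exists2 c, c != 0 &
  xz A S (wz A S (lphi A w) (sphi A S w)) = c *: col_mx y w.
Proof.
move=> yw u0; have [m0 w50 c0 a0] := ufun_neq0 u0.
have [r r0 ->] := wz_phi u0; exists (r ^+ 4 * (2%:R * mm A w)).
  by rewrite !mulf_neq0 ?expf_neq0.
by rewrite xzZ /xz (yz_base yw) -scale_col_mx scalerA.
Qed.

Lemma vfun_phi w : ufun A S w != 0 -> vfun A S (lphi A w) (sphi A S w) != 0.
Proof.
move=> u0; have [m0 w50 c0 a0] := ufun_neq0 u0; have k0 := kap_neq0 u0.
have [r r0 E] := wz_phi u0.
rewrite /vfun E mmZ /lphi ccZ alZ.
have -> : (kap A w *: l0 A w) ord_max 0 = kap A w * mm A w by rewrite mxE l0_last.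
by rewrite !mulf_neq0 ?expf_neq0.
Qed.

Lemma vfun_neq0 l s : vfun A S l s != 0 ->
  [/\ cc A l != 0, al A S l != 0, l ord_max 0 != 0 & mm A (wz A S l s) != 0].
Proof. by rewrite /vfun !mulf_eq0 !negb_or => /andP[/andP[/andP[-> ->] ->] ->]. Qed.

Lemma Al_wz l s : Al A l *m wz A S l s = 0.
Proof. by rewrite /wz mulmxA mul_nullmx mul0mx. Qed.

(** The quadratic formula: [(cc l * s - be l, al l)] is isotropic for the binary form because
    [cc l * s] is a square root of [be ^+ 2 - al * ga]. *)
Lemma wz_quad l s : cc A l != 0 -> s ^+ 2 = \det (Ql A S l) ->
  ((wz A S l s)^T *m lcomb S l *m wz A S l s) 0 0 = 0.
Proof.
move=> c0 sD; rewrite /wz quad_NN // ![abv _ _ _ _ _ _]mxE /=.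
have E := det_Ql Ssym c0; rewrite -sD in E.
transitivity (al A S l * (cc A l ^+ 2 * s ^+ 2 - (be A S l ^+ 2 - al A S l * ga A S l))).
  by ring.
by rewrite E subrr mulr0.
Qed.

(* Three of the four equations hold by Cramer's rule; the fourth follows from
   the linear relation [l] between them, whose last coefficient is nonzero. *)
Lemma on_base_yz (l : 'cV[K]_4) w : l ord_max 0 != 0 -> Al A l *m w = 0 ->
    (w^T *m lcomb S l *m w) 0 0 = 0 ->
  (M4 A w)^T *m (2%:R *: yz A S w) + (2%:R * mm A w) *: sv S w = 0.
Proof.
move=> l30 Aw wSw; set V := _ + _.
have V1 : usubmx V = 0.
  rewrite /V [usubmx _]linearD /= [usubmx (_ *: _)]linearZ /=.
  rewrite -{1}(hsubmxK (M4 A w)) tr_row_mx mul_col_mx col_mxKu.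
  rewrite -scalemxAr /yz mulmxN mulmxA -trmx_mul mul_adj_mx tr_scalar_mx mul_scalar_mx.
  by rewrite scalerN scalerA addNr.
have lV : l^T *m V = 0.
  rewrite /V mulmxDr mulmxA -trmx_mul M4_mul Aw trmx0 mul0mx add0r -scalemxAr.
  by apply/matrixP => i j; rewrite !ord1 [LHS]mxE sv_mul wSw mulr0 mxE.
rewrite -(vsubmxK V) V1; suff -> : dsubmx V = 0 by rewrite col_mx0.
apply/colP => i; rewrite [RHS]mxE ord1; apply: (mulfI l30); rewrite mulr0.
have := @mul_last_row 3 l V V1 lV; rewrite [dsubmx _ _ _]mxE => E.
by rewrite -[RHS]E; congr (l _ _ * _); apply: val_inj.
Qed.

Lemma psi_on_base l s : s ^+ 2 = \det (Ql A S l) -> vfun A S l s != 0 ->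
  on_base (yz A S (wz A S l s)) ((2%:R * mm A (wz A S l s)) *: wz A S l s).
Proof.
move=> sD v0; have [c0 a0 l30 m0] := vfun_neq0 v0.
have := on_base_yz l30 (Al_wz l s) (wz_quad c0 sD).
move: (2%:R * mm A (wz A S l s)) => t.
rewrite /on_base M4Z svZ [(_ *: _)^T]linearZ /= -scalemxAl expr2 -scalerA -scalerDr => ->.
by rewrite scaler0.
Qed.

Lemma w5_wz l s : w5 (wz A S l s) = cc A l * al A S l.
Proof. by rewrite /w5 /wz dsubmx_nullmx !mxE. Qed.

Lemma w4_wz l s : w4 (wz A S l s) = cc A l * (cc A l * s - be A S l).
Proof. by rewrite /w4 /wz dsubmx_nullmx !mxE. Qed.

Lemma l0_prop (l : 'cV[K]_4) w : Al A l *m w = 0 -> l ord_max 0 *: l0 A w = mm A w *: l.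
Proof.
move=> Aw; have := @nullmx_proportional K 3 1 1 (M4 A w) l.
rewrite M4_mul Aw => /(_ erefl); rewrite -/(mm A w) -/(l0 A w) => ->.
apply/colP => i; rewrite [LHS]mxE [RHS]mxE big_ord1 mulrC.
by congr (_ * _); rewrite mxE; congr (l _ _); apply: val_inj.
Qed.

Lemma l0_psi l s : vfun A S l s != 0 -> exists2 t, t != 0 &
  l0 A ((2%:R * mm A (wz A S l s)) *: wz A S l s) = t *: l.
Proof.
move=> v0; have [c0 a0 l30 m0] := vfun_neq0 v0; set w := wz A S l s.
exists ((2%:R * mm A w) ^+ 3 * (mm A w / l ord_max 0)).
  by rewrite !mulf_neq0 ?expf_neq0 ?invr_eq0 ?mulf_neq0.
rewrite l0Z -[RHS]scalerA; congr (_ *: _); apply: (scalerI l30).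
by rewrite l0_prop ?Al_wz // scalerA mulrC divfK.
Qed.

Lemma ufun_psi l s : vfun A S l s != 0 ->
  ufun A S ((2%:R * mm A (wz A S l s)) *: wz A S l s) != 0.
Proof.
move=> v0; have [c0 a0 l30 m0] := vfun_neq0 v0; have [t t0 E] := l0_psi v0.
rewrite /ufun E mmZ w5Z ccZ alZ w5_wz.
by rewrite !mulf_neq0 ?expf_neq0 ?mulf_neq0.
Qed.

(** At [wz l s] the form [al * w4 + be * w5] equals [cc ^+ 2 * al * s]: the terms without [s]
    cancel, and [s] is recovered with its sign. *)
Lemma phi_psi l s (w := (2%:R * mm A (wz A S l s)) *: wz A S l s) :
  vfun A S l s != 0 ->
  exists2 t, t != 0 & lphi A w = t *: l /\ sphi A S w = t ^+ 4 * s.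
Proof.
move=> v0; have [c0 a0 l30 m0] := vfun_neq0 v0; have [t t0 E] := l0_psi v0.
have k0 : kap A w != 0 by apply: kap_neq0; apply: ufun_psi v0.
exists (kap A w * t); first by rewrite mulf_neq0.
split; first by rewrite /lphi E scalerA.
have kE : kap A w = t ^+ 3 * cc A l * (2%:R * mm A (wz A S l s) * (cc A l * al A S l)).
  by rewrite /kap E ccZ /w w5Z w5_wz.
have [w4E w5E] : w4 w = 2%:R * mm A (wz A S l s) * (cc A l * (cc A l * s - be A S l)) /\
    w5 w = 2%:R * mm A (wz A S l s) * (cc A l * al A S l).
  by rewrite /w w4Z w5Z w4_wz w5_wz.
by rewrite /sphi E alZ beZ w4E w5E kE; ring.
Qed.

End Spec.

(** * Regularity of the maps in the web and the point *)

Section MapsAlgebra.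
Variables (K : fieldType) (T : Type) (P : (T -> K) -> Prop).
Hypothesis fa : funalg P.
Variables (A : T -> 'I_4 -> 'M[K]_(3, 5)) (S : T -> 'I_4 -> 'M[K]_5).
Hypothesis PA : forall k, fa_mx P (fun t => A t k).
Hypothesis PS : forall k, fa_mx P (fun t => S t k).

Lemma fa_lcomb m n (Q : T -> 'I_4 -> 'M[K]_(m, n)) l :
  (forall k, fa_mx P (fun t => Q t k)) -> fa_mx P l ->
  fa_mx P (fun t => lcomb (Q t) (l t)).
Proof.
move=> PQ Pl; apply: (fa_mx_sum fa) => k; apply: (fa_mxZ fa) => //.
Qed.

Lemma fa_nullmx p q (X : T -> 'M[K]_(p, p + q)) : fa_mx P X ->
  fa_mx P (fun t => nullmx (X t)).
Proof.
move=> PX; apply: (fa_col_mx fa).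
  apply: (fa_mxN fa); apply: (fa_mxM fa); last exact: (fa_rsubmx fa).
  by apply: (fa_adj fa); apply: (fa_lsubmx fa).
by apply: (fa_scalar_mx fa); apply: (fa_det fa); apply: (fa_lsubmx fa).
Qed.

Section OfLambda.
Variable l : T -> 'cV[K]_4.
Hypothesis Pl : fa_mx P l.

Lemma fa_Al : fa_mx P (fun t => Al (A t) (l t)).
Proof. exact: fa_lcomb. Qed.

Lemma fa_cc : P (fun t => cc (A t) (l t)).
Proof. by apply: (fa_det fa); apply: (fa_lsubmx fa); apply: fa_Al. Qed.

Lemma fa_NN : fa_mx P (fun t => NN (A t) (l t)).
Proof. exact: fa_nullmx fa_Al. Qed.

Lemma fa_TT : fa_mx P (fun t => TT (A t) (S t) (l t)).
Proof.
apply: (fa_mxM fa) fa_NN; apply: (fa_mxM fa); last exact: fa_lcomb.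
by apply: (fa_mxT fa); apply: fa_NN.
Qed.

Lemma fa_detQl : P (fun t => \det (Ql (A t) (S t) (l t))).
Proof.
apply: (fa_det fa); apply: (fa_col_mx fa); apply: (fa_row_mx fa).
- exact: (fa_mx_cst fa).
- exact: fa_Al.
- by apply: (fa_mxT fa); apply: fa_Al.
- exact: fa_lcomb.
Qed.

Variable s : T -> K.
Hypothesis Ps : P s.

Lemma fa_wz : fa_mx P (fun t => wz (A t) (S t) (l t) (s t)).
Proof.
apply: (fa_mxM fa); first exact: fa_NN.
apply: (fa_matrix fa (F := fun t i _ => if i == 0 then _ else _)) => i j.
case: (i == 0); last exact: fa_TT.
by apply: (fa_sub fa); [apply: (fa_mul fa) => //; apply: fa_cc | apply: fa_TT].
Qed.

End OfLambda.

Section OfW.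
Variable w : T -> 'cV[K]_5.
Hypothesis Pw : fa_mx P w.

Lemma fa_M4 : fa_mx P (fun t => M4 (A t) (w t)).
Proof. by apply: (fa_matrix fa) => i k; apply: (fa_mxM fa). Qed.

Lemma fa_mm : P (fun t => mm (A t) (w t)).
Proof. by apply: (fa_det fa); apply: (fa_lsubmx fa); apply: fa_M4. Qed.

Lemma fa_l0 : fa_mx P (fun t => l0 (A t) (w t)).
Proof. exact: fa_nullmx fa_M4. Qed.

Lemma fa_sv : fa_mx P (fun t => sv (S t) (w t)).
Proof.
apply: (fa_matrix fa) => k j; apply: (fa_mxM fa) Pw _ _; apply: (fa_mxM fa) => //.
exact: (fa_mxT fa).
Qed.

Lemma fa_xz : fa_mx P (fun t => xz (A t) (S t) (w t)).
Proof.
apply: (fa_col_mx fa); last first.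
  apply: (fa_mxZ fa) => //; apply: (fa_mul fa); first exact: (fa_cst fa).
  exact: fa_mm.
apply: (fa_mxN fa); apply: (fa_mxM fa); last first.
  by apply: (fa_usubmx fa); apply: fa_sv.
by apply: (fa_mxT fa); apply: (fa_adj fa); apply: (fa_lsubmx fa); apply: fa_M4.
Qed.

Lemma fa_w4 : P (fun t => w4 (w t)).
Proof. by apply: (fa_dsubmx fa). Qed.

Lemma fa_w5 : P (fun t => w5 (w t)).
Proof. by apply: (fa_dsubmx fa). Qed.

Lemma fa_kap : P (fun t => kap (A t) (w t)).
Proof. by apply: (fa_mul fa); [apply/fa_cc/fa_l0 | apply: fa_w5]. Qed.

Lemma fa_lphi : fa_mx P (fun t => lphi (A t) (w t)).
Proof. by apply: (fa_mxZ fa); [apply: fa_kap | apply: fa_l0]. Qed.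

Lemma fa_sphi : P (fun t => sphi (A t) (S t) (w t)).
Proof.
apply: (fa_mul fa); first by apply: (fa_exp fa); apply: fa_kap.
apply: (fa_add fa); apply: (fa_mul fa); first [exact: fa_w4|exact: fa_w5|idtac].
all: by apply: fa_TT fa_l0 _ _.
Qed.

Lemma fa_ufun : P (fun t => ufun (A t) (S t) (w t)).
Proof.
apply: (fa_mul fa); last by apply: fa_TT fa_l0 _ _.
apply: (fa_mul fa); last exact: fa_cc fa_l0.
by apply: (fa_mul fa); [apply: fa_mm | apply: fa_w5].
Qed.

End OfW.

Lemma fa_vfun l s : fa_mx P l -> P s -> P (fun t => vfun (A t) (S t) (l t) (s t)).
Proof.
move=> Pl Ps; apply: (fa_mul fa); last by apply/fa_mm/fa_wz.
apply: (fa_mul fa); last exact: Pl.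
by apply: (fa_mul fa); [apply: fa_cc | apply: fa_TT].
Qed.

End MapsAlgebra.

(** * Functions on a double cover [s ^+ 2 = D] *)

Section DoubleCoverAlgebra.
Variables (K : closedFieldType) (T : Type) (P : (T -> K) -> Prop).
Hypothesis fa : funalg P.
Variable D : T -> K.
Hypothesis PD : P D.

(** Functions that on the cover [s ^+ 2 = D t] have the form [g0 + s * g1]; off the cover [g] is
    arbitrary. *)
Definition dcfun (g : T * K -> K) := exists g0 g1, [/\ P g0, P g1 &
  forall t s, s ^+ 2 = D t -> g (t, s) = g0 t + s * g1 t].

Lemma dcfun_funalg : funalg dcfun.
Proof.
split.
- by move=> f g [g0 [g1 [P0 P1 E]]] fg; exists g0, g1; split=> // t s /E; rewrite fg.
- move=> c; exists (fun=> c), (fun=> 0); split; try exact: (fa_cst fa).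
  by move=> t s _; rewrite mulr0 addr0.
- move=> f g [f0 [f1 [Pf0 Pf1 Ef]]] [g0 [g1 [Pg0 Pg1 Eg]]].
  exists (fun t => f0 t + g0 t), (fun t => f1 t + g1 t).
  split; try exact: (fa_add fa).
  by move=> t s ts; rewrite (Ef _ _ ts) (Eg _ _ ts); ring.
- move=> f g [f0 [f1 [Pf0 Pf1 Ef]]] [g0 [g1 [Pg0 Pg1 Eg]]].
  exists (fun t => f0 t * g0 t + D t * (f1 t * g1 t)), (fun t => f0 t * g1 t + f1 t * g0 t).
  split; try by apply: (fa_add fa); do ?apply: (fa_mul fa).
  move=> t s ts; rewrite (Ef _ _ ts) (Eg _ _ ts) -ts; ring.
Qed.

Lemma dcfun_base f : P f -> dcfun (fun ts => f ts.1).
Proof.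
move=> Pf; exists f, (fun=> 0); split=> //; first exact: (fa_cst fa).
by move=> t s _; rewrite mulr0 addr0.
Qed.

Lemma dcfun_sqrt : dcfun (fun ts => ts.2).
Proof.
exists (fun=> 0), (fun=> 1); split; try exact: (fa_cst fa).
by move=> t s _; rewrite mulr1 add0r.
Qed.

Lemma sqrt_exists (a : K) : exists s, s ^+ 2 = a.
Proof.
have /closed_rootP[s] : size ('X^2 - a%:P : {poly K}) != 1%N.
  by rewrite size_XnsubC.
by rewrite rootE !hornerE subr_eq0 => /eqP; exists s.
Qed.

(** The norm [g0 ^+ 2 - D * g1 ^+ 2] is the product of the values of [g] at the two points over
    [t]. *)
Lemma dcfun_norm g : dcfun g -> exists2 N, P N & forall t,
  N t != 0 <-> forall s, s ^+ 2 = D t -> g (t, s) != 0.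
Proof.
move=> [g0 [g1 [P0 P1 E]]]; exists (fun t => g0 t ^+ 2 - D t * g1 t ^+ 2).
  apply: (fa_sub fa); first exact: (fa_exp fa).
  by apply: (fa_mul fa) => //; apply: (fa_exp fa).
have NE t s : s ^+ 2 = D t ->
    g0 t ^+ 2 - D t * g1 t ^+ 2 = g (t, s) * g (t, - s).
  by move=> ts; rewrite (E _ _ ts) E ?sqrrN // -ts; ring.
move=> t; split=> [N0 s ts|gs].
  by apply: contraNneq N0 => gts; rewrite (NE _ _ ts) gts mul0r.
have [s ts] := sqrt_exists (D t).
by rewrite (NE _ _ ts) mulf_neq0 ?gs // sqrrN.
Qed.

End DoubleCoverAlgebra.

(* A function [p0 + s p1] vanishing at both square roots has [p0 = p1 = 0]. *)
Lemma double_cover_dense (K : closedFieldType) n (D : ('I_n -> K) -> K) v p t0 :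
    2%:R != 0 :> K -> polyfun D ->
    dcfun (@polyfun K n) D v -> dcfun (@polyfun K n) D p ->
    D t0 != 0 -> (forall s, s ^+ 2 = D t0 -> v (t0, s) != 0) ->
    (forall t s, s ^+ 2 = D t -> s != 0 -> v (t, s) != 0 -> p (t, s) = 0) ->
  forall t s, s ^+ 2 = D t -> p (t, s) = 0.
Proof.
move=> two0 PD dv [p0 [p1 [P0 P1 E]]] D0 vt0 pv.
have fa := polyfun_funalg K n.
have [N PN NP] := dcfun_norm fa PD dv.
have N0 : N t0 * D t0 != 0 by rewrite mulf_neq0 //; apply/NP.
have PND : polyfun (fun t => N t * D t) by apply: (fa_mul fa).
have z t : N t * D t != 0 -> p0 t = 0 /\ p1 t = 0.
  rewrite mulf_eq0 negb_or => /andP[/NP vt Dt].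
  have [s ts] := sqrt_exists (D t).
  have s0 : s != 0 by apply: contraNneq Dt => s0; rewrite -ts s0 expr0n.
  have ts' : (- s) ^+ 2 = D t by rewrite sqrrN.
  have e1 := pv t s ts s0 (vt s ts); rewrite (E _ _ ts) in e1.
  have := pv t _ ts' _ (vt _ ts'); rewrite oppr_eq0 s0 (E _ _ ts') => /(_ isT) e2.
  have p00 : p0 t = 0.
    by apply: (mulfI two0); rewrite mulr0 -[RHS]addr0 -{1}e1 -e2; ring.
  split=> //; apply: (mulfI s0); rewrite mulr0 -e1 p00; ring.
have z0 := generic_eq0 PND P0 N0 (fun t nt => proj1 (z t nt)).
have z1 := generic_eq0 PND P1 N0 (fun t nt => proj2 (z t nt)).
by move=> t s ts; rewrite (E _ _ ts) z0 z1 mulr0 addr0.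
Qed.

Lemma C_natr_eq0 n : (n%:R == 0 :> C) = (n == 0%N).
Proof. exact: (@Num.Theory.pnatr_eq0 (complex Rdefinitions.R)). Qed.

(** Comparing coefficients at [m] for [t = 2] gives [2 ^+ wt m = 2 ^+ e], and the powers of 2 are
    distinct in characteristic zero. *)
Lemma whomog_scaling n (w : 'I_n -> nat) e (p : {mpoly C[n]}) :
  (forall t (x : 'I_n -> C), p.@[fun i => t ^+ w i * x i] = t ^+ e * p.@[x]) ->
  whomog w e p.
Proof.
move=> pt m mp; pose wt (m : 'X_{1..n}) := (\sum_i w i * m i)%N.
pose q : {mpoly C[n]} := \sum_(m <- msupp p) (2%:R ^+ wt m * p@_m) *: 'X_[m].
have : q - 2%:R ^+ e *: p = 0.
  apply: meval_inj => x; rewrite mevalB mevalZ -pt (mevalE _ p) /q rmorph_sum /=.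
  rewrite -sumrB big1 // => k _; rewrite mevalZ mevalX.
  have -> : \prod_i (2%:R ^+ w i * x i) ^+ k i = 2%:R ^+ wt k * \prod_i x i ^+ k i :> C.
    rewrite /wt -prodrXr -big_split; apply: eq_bigr => i _.
    by rewrite exprMn -exprM.
  by ring.
move/(congr1 (mcoeff m)); rewrite mcoeffB mcoeffZ mcoeff0 /q raddf_sum /=.
rewrite (bigD1_seq m) ?msupp_uniq //= big1 ?addr0 => [|k km]; last first.
  by rewrite mcoeffZ mcoeffX (negbTE km) mulr0.
rewrite mcoeffZ mcoeffX eqxx mulr1 -mulrBl => /eqP.
rewrite mulf_eq0 (negbTE (_ : p@_m != 0)) -?mcoeff_msupp // orbF -/(wt m).
move: mp => _; move: (wt m) => a; rewrite -!natrX.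
wlog ae : a e {pt} / (a <= e)%N.
  move=> H; case/orP: (leq_total a e) => [/H //|/H h].
  by rewrite -oppr_eq0 opprB => /h.
rewrite -oppr_eq0 opprB -natrB ?leq_exp2l // C_natr_eq0 subn_eq0 leq_exp2l // => ea.
by apply/eqP; rewrite eqn_leq ae.
Qed.

(** * Birationality for the standard plane *)

Lemma C_two_neq0 : 2%:R != 0 :> C.
Proof. by rewrite C_natr_eq0. Qed.

Definition yvec (x : 'I_8 -> C) : 'cV[C]_3 := usubmx (\col_i x i : 'cV[C]_(3 + 5)).
Definition wvec (x : 'I_8 -> C) : 'cV[C]_5 := dsubmx (\col_i x i : 'cV[C]_(3 + 5)).
Definition lvec (z : 'I_5 -> C) : 'cV[C]_4 := \col_k lam z k.

Lemma wvecZ t x : wvec (fun i => t ^+ 1 * x i) = t *: wvec x.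
Proof. by apply/colP => i; rewrite !mxE expr1. Qed.

Lemma lvecZ t z : lvec (fun j => t ^+ wZ j * z j) = t *: lvec z.
Proof.
apply/colP => k; rewrite !mxE /lam /wZ; case: eqP => [E|_]; last by rewrite expr1.
by have := neq_lift ord_max k; rewrite E eqxx.
Qed.

Lemma wcoordZ t z : wcoord (fun j => t ^+ wZ j * z j) = t ^+ 4 * wcoord z.
Proof. by rewrite /wcoord /wZ eqxx. Qed.

Lemma sum_bordered n p q (l : 'I_n -> C) (A : 'I_n -> 'M[C]_(p, q)) S :
  \sum_k l k *: block_mx 0 (A k) (A k)^T (S k) =
  block_mx 0 (\sum_k l k *: A k) (\sum_k l k *: A k)^T (\sum_k l k *: S k).
Proof.
apply/matrixP => i j; rewrite summxE -(splitK i) -(splitK j).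
case: (fintype.split i) => i'; case: (fintype.split j) => j' /=.
- by rewrite block_mxEul mxE big1 // => k _; rewrite mxE block_mxEul mxE mulr0.
- rewrite block_mxEur summxE; apply: eq_bigr => k _.
  by rewrite mxE block_mxEur !mxE.
- rewrite block_mxEdl mxE summxE; apply: eq_bigr => k _.
  by rewrite mxE block_mxEdl !mxE.
rewrite block_mxEdr summxE; apply: eq_bigr => k _.
by rewrite mxE block_mxEdr !mxE.
Qed.

Lemma bordered_quad p q (A : 'M[C]_(p, q)) S (y : 'cV_p) (w : 'cV_q) :
  ((col_mx y w)^T *m block_mx 0 A A^T S *m col_mx y w) 0 0 =
  2%:R * (w^T *m A^T *m y) 0 0 + (w^T *m S *m w) 0 0.
Proof.
rewrite tr_col_mx mul_row_block mulmx0 add0r mul_row_col mulmxDl.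
rewrite [LHS]mxE [X in _ + X]mxE addrA; congr (_ + _).
have -> : (y^T *m A *m w) 0 0 = (w^T *m A^T *m y) 0 0.
  by rewrite -[RHS]trace_mx11 -mxtrace_tr !trmx_mul !trmxK mulmxA trace_mx11.
by ring.
Qed.

Section StandardWeb.
Variables (A : 'I_4 -> 'M[C]_(3, 5)) (S : 'I_4 -> 'M[C]_5).
Hypothesis Ssym : forall k, (S k)^T = S k.

Definition stdweb (k : 'I_4) : 'M[C]_8 := (block_mx 0 (A k) (A k)^T (S k) : 'M_(3 + 5)).

Lemma web_member_std l : web_member stdweb l = Ql A S (\col_k l k).
Proof.
rewrite /web_member /Ql /Al /lcomb /stdweb.
rewrite -(@sum_bordered 4 3 5 (fun k => (\col_k l k : 'cV_4) k 0) A S).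
by apply: eq_bigr => k _; rewrite mxE.
Qed.

Lemma qform_std k x : qform (stdweb k) x =
  ((M4 A (wvec x))^T *m (2%:R *: yvec x) + sv S (wvec x)) k 0.
Proof.
transitivity (((col_mx (yvec x) (wvec x))^T *m block_mx 0 (A k) (A k)^T (S k)
    *m col_mx (yvec x) (wvec x)) 0 0).
  rewrite /yvec /wvec vsubmxK /qform /stdweb.
  have -> : \row_i x i = (\col_i x i)^T by apply/rowP => i; rewrite !mxE.
  by rewrite trmxK.
rewrite bordered_quad [RHS]mxE [sv _ _ _ _]mxE; congr (_ + _).
rewrite -scalemxAr [RHS]mxE; congr (_ * _); rewrite [LHS]mxE [RHS]mxE.
by apply: eq_bigr => i _; rewrite -trmx_mul [_^T k i]mxE [M4 _ _ _ _]mxE [_^T 0 i]mxE.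
Qed.

Lemma base_std x : (forall k, qform (stdweb k) x = 0) <->
  on_base A S (yvec x) (wvec x).
Proof.
split=> [q0|b k]; last by rewrite qform_std b mxE.
by apply/colP => k; rewrite -qform_std q0 mxE.
Qed.

Lemma det_std z : \det (web_member stdweb (lam z)) = \det (Ql A S (lvec z)).
Proof. by rewrite web_member_std. Qed.

(** Density on the affine cone, origin included; where [ufun] does not vanish the point is nonzero
    in any case. *)
Definition BS_dense := forall p : {mpoly C[8]},
  (forall x, (forall k, qform (stdweb k) x = 0) -> ufun A S (wvec x) != 0 -> p.@[x] = 0) ->
  forall x, (forall k, qform (stdweb k) x = 0) -> p.@[x] = 0.

(** A quadric over which the two points of the double cover are distinct and both lie in the open
    set; one such [l] gives density on the cover. *)
Definition cover_good (l : 'cV[C]_4) := \det (Ql A S l) != 0 /\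
  forall s, s ^+ 2 = \det (Ql A S l) -> vfun A S l s != 0.

Definition phi x (j : 'I_5) : C :=
  if unlift ord_max j is Some k then lphi A (wvec x) k 0 else sphi A S (wvec x).

Definition psi z (i : 'I_8) : C :=
  (xz A S (wz A S (lvec z) (wcoord z)) : 'cV_8) i 0.

Lemma lvec_phi x : lvec (phi x) = lphi A (wvec x).
Proof. by apply/colP => k; rewrite mxE /lam /phi liftK. Qed.

Lemma wcoord_phi x : wcoord (phi x) = sphi A S (wvec x).
Proof. by rewrite /wcoord /phi unlift_none. Qed.

Lemma polyfun_wvec : fa_mx (@polyfun C 8) wvec.
Proof.
apply: (fa_dsubmx (polyfun_funalg C 8)).
apply: (fa_matrix (polyfun_funalg C 8) (F := fun x i _ => x i)) => i j.
exact: polyfun_coord.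
Qed.

Lemma polyfun_lvec : fa_mx (@polyfun C 5) lvec.
Proof.
apply: (fa_matrix (polyfun_funalg C 5) (F := fun z k _ => lam z k)) => i j.
exact: polyfun_coord.
Qed.

Let cst_A n k : fa_mx (@polyfun C n) (fun=> A k).
Proof. exact: (fa_mx_cst (polyfun_funalg C n)). Qed.

Let cst_S n k : fa_mx (@polyfun C n) (fun=> S k).
Proof. exact: (fa_mx_cst (polyfun_funalg C n)). Qed.

Lemma polyfun_phi j : polyfun (fun x => phi x j).
Proof.
rewrite /phi; case: (unlift ord_max j) => [k|].
  by apply: (fa_lphi (polyfun_funalg C 8)) => //; apply: polyfun_wvec.
by apply: (fa_sphi (polyfun_funalg C 8)) => //; apply: polyfun_wvec.
Qed.

Lemma polyfun_wcoord : polyfun wcoord.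
Proof. exact: polyfun_coord. Qed.

Lemma polyfun_psi i : polyfun (fun z => psi z i).
Proof.
apply: (fa_xz (polyfun_funalg C 5)) => //; apply: (fa_wz (polyfun_funalg C 5)) => //.
  exact: polyfun_lvec.
exact: polyfun_wcoord.
Qed.

Lemma psi_split z (w := wz A S (lvec z) (wcoord z)) :
  yvec (psi z) = yz A S w /\ wvec (psi z) = (2%:R * mm A w) *: w.
Proof.
have -> : yvec (psi z) = usubmx (xz A S w).
  by rewrite /yvec; congr usubmx; apply/colP => i; rewrite mxE.
have -> : wvec (psi z) = dsubmx (xz A S w).
  by rewrite /wvec; congr dsubmx; apply/colP => i; rewrite mxE.
by rewrite col_mxKu col_mxKd.
Qed.

Lemma w5_nonzero_pt x : w5 (wvec x) != 0 -> nonzero_pt x.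
Proof.
move=> w0; exists (@rshift 3 5 (@rshift 3 2 1)); apply: contraNneq w0 => x0.
by rewrite /w5 /wvec !mxE x0.
Qed.

Lemma ufun_nonzero_pt x : ufun A S (wvec x) != 0 -> nonzero_pt x.
Proof. by case/ufun_neq0 => _ w0 _ _; apply: w5_nonzero_pt. Qed.

Lemma vfun_nonzero_pt z : vfun A S (lvec z) (wcoord z) != 0 -> nonzero_pt z.
Proof.
case/vfun_neq0 => _ _ l3 _; exists (lift ord_max ord_max).
by apply: contraNneq l3 => z0; rewrite mxE /lam z0.
Qed.

Lemma dense_cover l : cover_good l ->
  dense_in (double_cover stdweb) (fun z => vfun A S (lvec z) (wcoord z) != 0).
Proof.
move=> [D0 vl] p pv z [_ zD].
pose E (ts : ('I_4 -> C) * C) : 'I_5 -> C :=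
  fun j => if unlift ord_max j is Some k then ts.1 k else ts.2.
have lvecE ts : lvec (E ts) = \col_k ts.1 k.
  by apply/colP => k; rewrite !mxE /lam /E liftK.
have wE ts : wcoord (E ts) = ts.2 by rewrite /wcoord /E unlift_none.
pose D (t : 'I_4 -> C) := \det (Ql A S (\col_k t k)).
have fa4 := polyfun_funalg C 4.
have Pl : fa_mx (@polyfun C 4) (fun t => \col_k t k : 'cV_4).
  by apply: (fa_matrix fa4 (F := fun t k _ => t k)) => k _; apply: polyfun_coord.
have PD : polyfun D by apply: (fa_detQl fa4).
have fa := dcfun_funalg fa4 PD.
have PE j : dcfun (@polyfun C 4) D (fun ts => E ts j).
  rewrite /E; case: (unlift ord_max j) => [k|]; last exact: dcfun_sqrt.
  by apply: (dcfun_base fa4 D (f := fun t => t k)); apply: polyfun_coord.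
have zE : forall j, z j = E (lam z, wcoord z) j.
  by move=> j; rewrite /E; case: unliftP => [k|] ->.
rewrite (meval_eq _ zE).
have lE t : \col_k (t : 'cV[C]_4) k 0 = t by apply/colP => k; rewrite mxE.
pose vE ts := vfun A S (lvec (E ts)) (wcoord (E ts)).
have Pv : dcfun (@polyfun C 4) D vE.
  apply: (fa_vfun fa).
  - by move=> k; apply: (fa_mx_cst fa).
  - by move=> k; apply: (fa_mx_cst fa).
  - by move=> i j; apply: (fa_ext fa (PE (lift ord_max i))) => ts; rewrite mxE.
  - exact: PE.
have Pp : dcfun (@polyfun C 4) D (fun ts => p.@[E ts]) by apply: (fa_meval fa).
have D0' : D (fun k => l k 0) != 0 by rewrite /D lE.
have v0 s : s ^+ 2 = D (fun k => l k 0) -> vE (fun k => l k 0, s) != 0.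
  by rewrite /D /vE lvecE wE /= lE; apply: vl.
(* [s != 0] guarantees that [(t, s)] is not the origin, as membership in [double_cover] demands. *)
have pv' t s : s ^+ 2 = D t -> s != 0 -> vE (t, s) != 0 -> p.@[E (t, s)] = 0.
  move=> ts s0 vts; apply: pv => //; split.
    by exists ord_max; rewrite -/(wcoord _) wE.
  by rewrite det_std lvecE wE.
apply: (double_cover_dense C_two_neq0 PD Pv Pp D0' v0 pv').
by rewrite zD det_std.
Qed.

Lemma BS_ext x y : x =1 y -> wvec x = wvec y.
Proof. by move=> xy; apply/colP => i; rewrite !mxE xy. Qed.

Theorem birational_std l : BS_dense -> cover_good l -> birational_BS_Z stdweb.
Proof.
move=> dBS gl; have two0 := C_two_neq0.
have /fin_all_exists[f fE] j : exists p : {mpoly C[8]}, forall x, p.@[x] = phi x j.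
  exact: polyfun_phi.
have /fin_all_exists[h hE] i : exists p : {mpoly C[5]}, forall z, p.@[z] = psi z i.
  exact: polyfun_psi.
have [u uE] : polyfun (fun x => ufun A S (wvec x)).
  by apply: (fa_ufun (polyfun_funalg C 8)) => //; apply: polyfun_wvec.
have [v vE] : polyfun (fun z => vfun A S (lvec z) (wcoord z)).
  apply: (fa_vfun (polyfun_funalg C 5)) => //; first exact: polyfun_lvec.
  exact: polyfun_wcoord.
(* The degrees: 13 for [lphi], with [52 = 4 * 13] for [sphi] of weight 4; [40 = 4 * 10] for [xz]
   after [wz]; 34 for [ufun] and 41 for [vfun]. *)
exists 13%N, 40%N, 34%N, 41%N, f, h, u, v; split.
- split=> [j|i]; apply: whomog_scaling => t x.
    rewrite !fE /phi wvecZ /wZ; case: unliftP => [k|] ->.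
      by rewrite eq_sym (negbTE (neq_lift _ _)) lphiZ mxE.
    by rewrite eqxx sphiZ.
  by rewrite !hE /psi lvecZ wcoordZ wzZ xzZ mxE -exprM.
- split; apply: whomog_scaling => t x; first by rewrite !uE wvecZ ufunZ.
  by rewrite !vE lvecZ wcoordZ vfunZ.
- split.
    move=> p pu x [_ xb]; apply: dBS xb => y yb uy; apply: pu; rewrite ?uE //.
    by split=> //; apply: ufun_nonzero_pt.
  move=> p pv; apply: (dense_cover gl) => z zD vz; apply: pv => //.
  by rewrite vE.
- move=> x [_ /base_std xb]; rewrite uE => ux z.
  have lz : lvec z = lphi A (wvec x).
    by rewrite -lvec_phi; apply/colP => k; rewrite !mxE /lam /z fE.
  have wz' : wcoord z = sphi A S (wvec x) by rewrite -wcoord_phi /wcoord /z fE.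
  have vz : vfun A S (lvec z) (wcoord z) != 0.
    by rewrite lz wz'; apply: vfun_phi.
  split; first split; first exact: vfun_nonzero_pt.
  + by rewrite det_std lz wz'; apply: phi_on_cover xb ux.
  + by rewrite vE.
  have [c c0 cE] := xz_phi two0 xb ux; exists c => // i.
  rewrite hE /psi lz wz' cE mxE /yvec /wvec vsubmxK.
  by rewrite mxE.
move=> z [_ zD]; rewrite vE => vz x; rewrite det_std in zD.
set w := wz A S (lvec z) (wcoord z).
have [xy xw] := psi_split z.
have wx : wvec x = (2%:R * mm A w) *: w.
  by rewrite -xw; apply: BS_ext => i; rewrite /x hE.
have yx : yvec x = yz A S w.
  by rewrite -xy; congr usubmx; apply/colP => i; rewrite !mxE /x hE.
have ux : ufun A S (wvec x) != 0 by rewrite wx; apply: ufun_psi.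
split; first split; first exact: ufun_nonzero_pt.
+ by apply/base_std; rewrite wx yx; apply: psi_on_base.
+ by rewrite uE.
have [t t0 [lt st]] := phi_psi two0 vz; rewrite -/w in lt st.
exists t => // j; rewrite fE /phi wx /wZ; case: unliftP => [k|] ->.
  by rewrite eq_sym (negbTE (neq_lift _ _)) lt !mxE.
by rewrite eqxx st.
Qed.

End StandardWeb.

(** * A web satisfying the genericity conditions *)

Lemma compress_drsubmx p q (X : 'M[C]_(p + q)) :
  (col_mx 0 1%:M)^T *m X *m col_mx 0 1%:M = drsubmx X.
Proof.
rewrite -{1}[X]submxK tr_col_mx trmx0 trmx1 mul_row_block !mul0mx !mul1mx !add0r.
by rewrite mul_row_col mulmx0 mulmx1 add0r.
Qed.

Lemma mul_row_1_0 p q (w : 'cV[C]_(p + q)) : row_mx 1%:M 0 *m w = usubmx w.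
Proof. by rewrite -{1}(vsubmxK w) mul_row_col mul1mx mul0mx addr0. Qed.

Lemma col_mx_0_1 p : col_mx 0 1%:M = delta_mx (rshift p 0) 0 :> 'cV[C]_(p + 1).
Proof.
apply/colP => i; rewrite [RHS]mxE andbT -(splitK i).
case: (fintype.split i) => k /=; first by rewrite col_mxEu mxE eq_lrshift.
by rewrite col_mxEd !ord1 !mxE !eqxx.
Qed.

Section Example.
Variable e : C.

(** In coordinates [y_1..y_3, w_1..w_5] the quadrics of the example are [2 e y_k w_5 + w_k^2] for
    [k = 1, 2, 3] and [2 e (y_1 w_1 + y_2 w_2 + y_3 w_3) + w_4^2 - e^2 w_5^2]. At [e = 0] they are
    four squares, for which freeness is evident; for nonzero [e] the open sets of the two maps have
    points. *)
Definition exA (k : 'I_4) : 'M[C]_(3, 5) :=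
  if unlift ord_max k is Some k' then e *: delta_mx k' ord_max
  else (e *: row_mx 1%:M 0 : 'M_(3, 3 + 2)).

Definition exS (k : 'I_4) : 'M[C]_5 :=
  delta_mx (lift ord_max k) (lift ord_max k) -
  (if k == ord_max then e ^+ 2 *: delta_mx ord_max ord_max else 0).

(** The last quadric of the web. In the example with [e] nonzero, [A_l] has kernel
    [w_1 = w_2 = w_3 = 0] there, and [S_l] restricts to [w_4^2 - e^2 w_5^2], which has two distinct
    isotropic lines. *)
Definition lam3 : 'cV[C]_4 := delta_mx ord_max 0.

Lemma exS_sym k : (exS k)^T = exS k.
Proof.
rewrite /exS linearB /= trmx_delta; congr (_ - _).
by case: ifP => _; rewrite ?trmx0 // linearZ /= trmx_delta.
Qed.

Lemma lcomb_lam3 m n (Q : 'I_4 -> 'M[C]_(m, n)) : lcomb Q lam3 = Q ord_max.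
Proof.
rewrite /lcomb (bigD1 ord_max) //= mxE !eqxx scale1r big1 ?addr0 // => k kl.
by rewrite mxE (negbTE kl) scale0r.
Qed.

Lemma exAl : Al exA lam3 = e *: row_mx 1%:M 0.
Proof. by rewrite /Al lcomb_lam3 /exA unlift_none. Qed.

Lemma ex_cc : cc exA lam3 = e ^+ 3.
Proof. by rewrite /cc exAl [lsubmx _]linearZ /= row_mxKl detZ det1 mulr1. Qed.

Lemma ex_NN : NN exA lam3 = e ^+ 3 *: col_mx 0 1%:M.
Proof.
rewrite /NN exAl nullmx3Z /nullmx row_mxKl row_mxKr mulmx0 oppr0 det1.
by [].
Qed.

Lemma ex_TT : TT exA exS lam3 = e ^+ 6 *: drsubmx (exS ord_max : 'M_(3 + 2)).
Proof.
rewrite /TT ex_NN lcomb_lam3 [(_ *: _)^T]linearZ /= -scalemxAr -!scalemxAl scalerA.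
rewrite -exprD; congr (_ *: _); exact: (@compress_drsubmx 3 2 (exS ord_max)).
Qed.

Lemma ex_al : al exA exS lam3 = e ^+ 6.
Proof. by rewrite /al ex_TT /exS eqxx !mxE /= mulr0 subr0 mulr1. Qed.

Lemma ex_be : be exA exS lam3 = 0.
Proof. by rewrite /be ex_TT /exS eqxx !mxE /= mulr0 subr0 mulr0. Qed.

Lemma ex_ga : ga exA exS lam3 = - e ^+ 8.
Proof.
rewrite /ga ex_TT /exS eqxx !mxE /=; ring.
Qed.

Hypothesis e0 : e != 0.

Lemma ex_det : \det (Ql exA exS lam3) != 0.
Proof.
have c0 : cc exA lam3 != 0 by rewrite ex_cc expf_neq0.
have := det_Ql exS_sym c0; rewrite ex_al ex_be ex_ga => E.
apply: contra_eq_neq E => ->; rewrite mulr0 eq_sym expr0n /= sub0r mulrN opprK.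
by rewrite -exprD expf_neq0.
Qed.

Lemma ex_mm w : mm exA w = (e * w5 w) ^+ 3.
Proof.
rewrite /mm; have -> : lsubmx (M4 exA w) = (e * w5 w)%:M.
  apply/matrixP => i j; rewrite [LHS]mxE [M4 _ _ _ _]mxE.
  have jl : lshift 1 j = lift ord_max j by apply: val_inj; rewrite /= /bump leqNgt ltn_ord.
  rewrite jl /exA liftK -scalemxAl mxE mxE (bigD1 ord_max) //= big1 ?addr0; last first.
    by move=> k /negbTE kl; rewrite mxE kl andbF mul0r.
  rewrite [delta_mx _ _ _ _]mxE eqxx andbT [RHS]mxE -[RHS]mulr_natr -mulrA.
  congr (_ * _); rewrite mulrC /w5 mxE; congr (w _ _ * _).
  exact: val_inj.
by rewrite det_scalar.
Qed.

(** No factor involves [s], as [w5 (wz l s) = cc l * al l]: both points of the double cover over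
    [lam3] are in the open set. *)
Lemma ex_vfun s : vfun exA exS lam3 s != 0.
Proof.
rewrite /vfun ex_mm w5_wz ex_cc ex_al mxE !eqxx.
by rewrite !mulf_neq0 ?expf_neq0 ?mulf_neq0 ?expf_neq0 ?oner_eq0.
Qed.

Lemma ex_l0 (w : 'cV_(3 + 2)) : usubmx w = 0 -> l0 exA w = mm exA w *: lam3.
Proof.
move=> w0; rewrite /l0 /nullmx.
have -> : rsubmx (M4 exA w) = 0.
  apply/matrixP => i j; rewrite [LHS]mxE [M4 _ _ _ _]mxE.
  have -> : rshift 3 j = ord_max by rewrite ord1; apply: val_inj.
  rewrite /exA unlift_none -scalemxAl (@mul_row_1_0 3 2 w) w0.
  by rewrite scaler0 !mxE.
rewrite mulmx0 oppr0 -/(mm exA w).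
have -> : lam3 = (col_mx 0 1%:M : 'cV_(3 + 1)).
  by rewrite col_mx_0_1 /lam3; congr (delta_mx _ 0); apply: val_inj.
apply: etrans (esym (scale_col_mx _ _ _)).
by rewrite scaler0 scale_scalar_mx mulr1.
Qed.

Lemma ex_ufun w : usubmx (w : 'cV_(3 + 2)) = 0 -> w5 w != 0 -> ufun exA exS w != 0.
Proof.
move=> w0 w50; rewrite /ufun ex_l0 // ccZ alZ ex_mm ex_cc ex_al.
by rewrite !mulf_neq0 ?expf_neq0 ?mulf_neq0 ?expf_neq0 ?mulf_neq0.
Qed.

End Example.

Lemma quad_delta n (w : 'cV[C]_n) a b : (w^T *m delta_mx a b *m w) 0 0 = w a 0 * w b 0.
Proof.
rewrite mxE (bigD1 b) //= big1 ?addr0 => [|j jb].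
  rewrite mxE (bigD1 a) //= big1 ?addr0 => [|i ia].
    by rewrite !mxE !eqxx mulr1.
  by rewrite !mxE (negbTE ia) mulr0.
rewrite mxE big1 ?mul0r // => i _.
by rewrite !mxE (negbTE jb) andbF mulr0.
Qed.

Lemma scalemxE m n a (M : 'M[C]_(m, n)) i j : (a *: M) i j = a * M i j.
Proof. by rewrite mxE. Qed.

Lemma ex_sv e w k : sv (exS e) w k 0 =
  w (lift ord_max k) 0 ^+ 2 - (k == ord_max)%:R * (e * w ord_max 0) ^+ 2.
Proof.
rewrite mxE /exS mulmxBr mulmxBl [LHS]mxE quad_delta -expr2; congr (_ + _).
rewrite mxE; case: eqP => _; last by rewrite mulmx0 mul0mx mxE mul0r.
by rewrite -scalemxAr -scalemxAl mxE quad_delta mul1r exprMn.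
Qed.

Lemma ex_qform e (k : 'I_3) x : qform (stdweb (exA e) (exS e) (lift ord_max k)) x =
  2%:R * e * yvec x k 0 * wvec x ord_max 0 +
  wvec x (lift ord_max (lift ord_max k)) 0 ^+ 2.
Proof.
rewrite qform_std mxE ex_sv eq_sym (negbTE (neq_lift _ _)) mul0r subr0; congr (_ + _).
rewrite mxE (bigD1 k) //= big1 ?addr0 => [|i ik].
  rewrite [_^T _ _]mxE [M4 _ _ _ _]mxE /exA liftK -scalemxAl scalemxE.
  rewrite [(_ *m _) k 0]mxE (bigD1 ord_max) //= big1 ?addr0 => [|j jm].
    by rewrite [delta_mx _ _ _ _]mxE !eqxx scalemxE mul1r; ring.
  by rewrite mxE (negbTE jm) andbF mul0r.
rewrite [_^T _ _]mxE [M4 _ _ _ _]mxE /exA liftK -scalemxAl scalemxE.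
rewrite [(_ *m _) i 0]mxE big1 ?mulr0 ?mul0r // => j _.
by rewrite mxE (negbTE ik) mul0r.
Qed.

Lemma ex_qform0 k x : qform (stdweb (exA 0) (exS 0) k) x =
  wvec x (lift ord_max k) 0 ^+ 2.
Proof.
rewrite qform_std mxE ex_sv mul0r expr0n mulr0 subr0.
suff -> : M4 (exA 0) (wvec x) = 0 by rewrite trmx0 mul0mx mxE add0r.
apply/matrixP => i j; rewrite mxE /exA.
by case: (unlift _ _) => [k'|]; rewrite scale0r mul0mx !mxE.
Qed.

(** * The universal web *)

Section Universal.

Let R := {mpoly C[NPar]}.

Definition pidx (k : 'I_4) (a b : 'I_8) : 'I_NPar := enum_rank ((k, a, b) : ParIdx).

Lemma coords_pidx Qs k a b : coords Qs (pidx k a b) = Qs k a b.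
Proof. by rewrite /coords /pidx enum_rankK. Qed.

Definition webmx (c : 'I_NPar -> C) (k : 'I_4) : 'M[C]_8 := \matrix_(a, b) c (pidx k a b).

Lemma webmx_coords Qs : webmx (coords Qs) = Qs.
Proof.
by apply: functional_extensionality => k; apply/matrixP => a b; rewrite mxE coords_pidx.
Qed.

Definition webA c k : 'M[C]_(3, 5) := ursubmx (webmx c k : 'M_(3 + 5)).
Definition webS c k : 'M[C]_5 := drsubmx (webmx c k : 'M_(3 + 5)).

Lemma webA_std A S : webA (coords (stdweb A S)) = A.
Proof.
apply: functional_extensionality => k; rewrite /webA webmx_coords /stdweb.
exact: (@block_mxKur _ 3 5 3 5).
Qed.

Lemma webS_std A S : webS (coords (stdweb A S)) = S.
Proof.
apply: functional_extensionality => k; rewrite /webS webmx_coords /stdweb.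
exact: (@block_mxKdr _ 3 5 3 5).
Qed.

Lemma qformE Q x : qform Q x = \sum_a \sum_b Q a b * (x a * x b).
Proof.
rewrite /qform mxE exchange_big; apply: eq_bigr => b _; rewrite !mxE mulr_suml.
by apply: eq_bigr => a _; rewrite !mxE; ring.
Qed.

(* The four coordinates [w_1, ..., w_4] are those on which the quadrics are
   used; on the remaining four the squares of the coordinates complete them to
   a system of eight quadrics in eight variables. *)
Definition widx (k : 'I_4) : 'I_8 := @rshift 3 5 (lift ord_max k).
Definition wrank (i : 'I_8) : option 'I_4 := [pick k | widx k == i].

Lemma widxK k : wrank (widx k) = Some k.
Proof.
rewrite /wrank; case: pickP => [k' /eqP E|/(_ k)]; last by rewrite eqxx.
congr Some; apply: (@lift_inj _ ord_max); exact: (@rshift_inj 3 5).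
Qed.

Lemma wrank_some i k : wrank i = Some k -> i = widx k.
Proof. by rewrite /wrank; case: pickP => // k' /eqP <- [->]. Qed.

Definition usq (i : 'I_8) : {mpoly R[8]} :=
  if wrank i is Some k then \sum_a \sum_b 'X_(pidx k a b) *: ('X_a * 'X_b)
  else 'X_i * 'X_i.

Local Notation sp c p := (map_mpoly (meval c) p).

Lemma usq_size c i : (msize (sp c (usq i)) <= 3)%N.
Proof.
have h a b : (msize ('X_a * 'X_b : {mpoly C[8]}) <= 3)%N.
  by rewrite -mpolyXD msizeX mdegD !mdeg1.
have small : forall p q : {mpoly C[8]}, (msize p <= 3)%N -> (msize q <= 3)%N ->
  (msize (p + q) <= 3)%N by move=> p q; apply: msizeD_leS.
rewrite /usq; case: wrank => [k|]; last by rewrite rmorphM /= !map_mpolyX.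
rewrite rmorph_sum; apply: (big_ind (fun p => (msize p <= 3)%N)) => // [|a _].
  by rewrite msize0.
rewrite rmorph_sum; apply: (big_ind (fun p => (msize p <= 3)%N)) => // [|b _].
  by rewrite msize0.
rewrite /= map_mpolyZ rmorphM /= !map_mpolyX.
by rewrite (leq_trans (msizeZ_le _ _)).
Qed.

Lemma usq_eval c i x : (sp c (usq i)).@[x] =
  if wrank i is Some k then qform (webmx c k) x else x i ^+ 2.
Proof.
rewrite /usq; case: wrank => [k|]; last first.
  by rewrite rmorphM /= map_mpolyX mevalM mevalXU expr2.
rewrite qformE (rmorph_sum (map_mpoly _)) rmorph_sum /=; apply: eq_bigr => a _.
rewrite (rmorph_sum (map_mpoly _)) rmorph_sum /=; apply: eq_bigr => b _.
by rewrite map_mpolyZ /= mevalZ mevalXU rmorphM /= !map_mpolyX mevalM !mevalXU mxE.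
Qed.

(** Polynomials in the point with coefficients polynomial in the web, the form in which
    [generic_fibre] takes its [u]. *)
Definition polyfun2 (g : ('I_NPar -> C) * ('I_8 -> C) -> C) :=
  exists U : {mpoly R[8]}, forall c x, (sp c U).@[x] = g (c, x).

Lemma polyfun2_funalg : funalg polyfun2.
Proof.
split.
- by move=> f g [p pf] fg; exists p => c x; rewrite pf.
- by move=> a; exists (a%:MP)%:MP => c x; rewrite map_mpolyC /= !mevalC.
- by move=> f g [p pf] [q qg]; exists (p + q) => c x; rewrite -pf -qg (rmorphD (map_mpoly (meval c))) mevalD.
- by move=> f g [p pf] [q qg]; exists (p * q) => c x; rewrite -pf -qg (rmorphM (map_mpoly (meval c))) mevalM.
Qed.

Lemma polyfun2_coord i : polyfun2 (fun t => t.1 i).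
Proof. by exists ('X_i)%:MP => c x; rewrite map_mpolyC /= mevalC mevalXU. Qed.

Lemma polyfun2_var i : polyfun2 (fun t => t.2 i).
Proof. by exists 'X_i => c x; rewrite map_mpolyX mevalXU. Qed.

Section WebAlgebra.
Variables (T : Type) (P : (T -> C) -> Prop) (fa : funalg P) (c : T -> 'I_NPar -> C).
Hypothesis Pc : forall i, P (fun t => c t i).

Lemma fa_webmx k : fa_mx P (fun t => webmx (c t) k).
Proof. by apply: (fa_matrix fa (F := fun t a b => c t (pidx k a b))) => a b; apply: Pc. Qed.

Lemma fa_webA k : fa_mx P (fun t => webA (c t) k).
Proof.
move=> i j; apply: (fa_ext fa (@fa_webmx k (@lshift 3 5 i) (@rshift 3 5 j))) => t.
by rewrite /webA [RHS]mxE [RHS]mxE.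
Qed.

Lemma fa_webS k : fa_mx P (fun t => webS (c t) k).
Proof.
move=> i j; apply: (fa_ext fa (@fa_webmx k (@rshift 3 5 i) (@rshift 3 5 j))) => t.
by rewrite /webS [RHS]mxE [RHS]mxE.
Qed.

End WebAlgebra.

Lemma universal_ufun : exists U : {mpoly R[8]}, forall c x,
  (sp c U).@[x] = ufun (webA c) (webS c) (wvec x).
Proof.
have fa := polyfun2_funalg.
pose T := (('I_NPar -> C) * ('I_8 -> C))%type.
have PA k : fa_mx polyfun2 (fun t : T => webA t.1 k).
  by apply: (fa_webA fa (c := fst)); apply: polyfun2_coord.
have PS k : fa_mx polyfun2 (fun t : T => webS t.1 k).
  by apply: (fa_webS fa (c := fst)); apply: polyfun2_coord.
have Pw : fa_mx polyfun2 (fun t : T => wvec t.2).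
  move=> i j; apply: (fa_ext fa (polyfun2_var (@rshift 3 5 i))) => t.
  by rewrite !mxE.
exact: (fa_ufun fa PA PS Pw).
Qed.

Definition ex_web e := coords (stdweb (exA e) (exS e)).

Lemma polyfun_ex_web i : polyfun (fun v : 'I_1 -> C => ex_web (v ord0) i).
Proof.
have fa := polyfun_funalg C 1; have Pv := @polyfun_coord C 1 ord0.
rewrite /ex_web /coords; case: (enum_val i) => [[k a] b].
suff : fa_mx (@polyfun C 1) (fun v : 'I_1 -> C => stdweb (exA (v ord0)) (exS (v ord0)) k) by [].
have PA : fa_mx (@polyfun C 1) (fun v : 'I_1 -> C => exA (v ord0) k).
  rewrite /exA; case: (unlift ord_max k) => [k'|].
    exact: (fa_mxZ fa Pv (fa_mx_cst fa (delta_mx k' ord_max))).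
  exact: (fa_mxZ fa Pv (fa_mx_cst fa (row_mx 1%:M 0 : 'M_(3, 3 + 2)))).
have PS : fa_mx (@polyfun C 1) (fun v : 'I_1 -> C => exS (v ord0) k).
  apply: (fa_mxD fa); first exact: (fa_mx_cst fa).
  apply: (fa_mxN fa); case: (k == ord_max); last exact: (fa_mx_cst fa).
  by apply: (fa_mxZ fa); [apply: (fa_exp fa) | apply: (fa_mx_cst fa)].
exact: (fa_col_mx fa (fa_row_mx fa (fa_mx_cst fa (0 : 'M_(3, 3))) PA)
                     (fa_row_mx fa (fa_mxT fa PA) PS)).
Qed.

(** For the squares of the variables [Psi] is the identity. *)
Lemma Hmx_squares n (sq : 'I_n -> {mpoly C[n]}) d :
  (forall i, sq i = 'X_i * 'X_i) -> Hmx sq d = 1%:M.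
Proof.
move=> sqE; apply/matrixP => i j; rewrite !mxE.
suff -> : PsiX sq (bmon i) = 'X_[bmon i].
  by rewrite mcoeffX (inj_eq (@bmon_inj _ _)).
rewrite /PsiX; have -> : qmon sq (mhalf (bmon i)) = 'X_[mhalf (bmon i) *+ 2].
  rewrite mpolyXE_id; apply: eq_bigr => k _.
  by rewrite sqE -expr2 -exprM mulmnE mulnC.
by rewrite -mpolyXD -mpar_half.
Qed.

Lemma ex_web_Hmx0 d : Hmx (fun i => sp (ex_web 0) (usq i)) d = 1%:M.
Proof.
apply: Hmx_squares => i; apply/eqP; rewrite -subr_eq0; apply/eqP; apply: meval_inj => x.
rewrite mevalB mevalM mevalXU usq_eval; case E: (wrank i) => [k|].
  rewrite /ex_web webmx_coords ex_qform0 (wrank_some E) /widx !mxE -expr2.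
  by rewrite subrr.
by rewrite -expr2 subrr.
Qed.

(** The determinants are 1 at [e = 0] and polynomial in [e], so they remain nonzero at some nonzero
    [e]. *)
Lemma ex_web_Hmx B : exists2 e, e != 0 &
  forall d, (d <= B)%N -> \det (Hmx (fun i => sp (ex_web e) (usq i)) d) != 0.
Proof.
pose F : R := \prod_(d < B.+1) \det (Hmx usq d).
have FE c : F.@[c] = \prod_(d < B.+1) \det (Hmx (fun i => sp c (usq i)) d).
  by rewrite /F rmorph_prod; apply: eq_bigr => d _; rewrite /= -det_map_mx map_Hmx.
have fa := polyfun_funalg C 1.
pose g (v : 'I_1 -> C) := F.@[ex_web (v ord0)].
have Pg : polyfun g by apply: (fa_meval fa) => i; apply: polyfun_ex_web.
have g0 : g (fun=> 0) != 0.
  rewrite /g FE; apply/prodf_neq0 => d _.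
  by rewrite ex_web_Hmx0 det1 oner_eq0.
have [v [e0 ge]] := @polyfun_common_neq0 C 1 (fun v => v ord0) g (fun=> 1) (fun=> 0)
  (@polyfun_coord C 1 ord0) Pg (oner_neq0 C) g0.
exists (v ord0) => // d dB; move: ge; rewrite /g FE => /prodf_neq0 ge.
exact: (ge (Ordinal (dB : (d < B.+1)%N)) isT).
Qed.

Lemma wrank_y (k : 'I_3) : wrank (@lshift 3 5 k) = None.
Proof.
rewrite /wrank; case: pickP => // k' /eqP/(congr1 val) /= E.
by have := ltn_ord k; rewrite -E.
Qed.

Lemma wrank_last : wrank ord_max = None.
Proof.
rewrite /wrank; case: pickP => // k' /eqP/(congr1 val).
by case: k' => [[|[|[|[|//]]]]].
Qed.

(** Zero on the four quadrics of the web and on the squares of [y_1, y_2, y_3]; one on the square of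
    [w_5]. *)
Definition s_ex (i : 'I_8) : C := (i == ord_max)%:R.

(** On this fibre [y = 0], so the first three quadrics reduce to [w_k^2] and force
    [w_1 = w_2 = w_3 = 0], while [w_5^2 = 1]; there [ex_ufun] applies. *)
Lemma ex_fibre e x : e != 0 ->
  (forall i, (sp (ex_web e) (usq i)).@[x] = s_ex i) ->
  ufun (webA (ex_web e)) (webS (ex_web e)) (wvec x) != 0.
Proof.
move=> e0 xs; rewrite webA_std webS_std; apply: ex_ufun => //.
  apply/colP => k; rewrite [RHS]mxE [LHS]mxE.
  have y0 : yvec x k 0 = 0.
    have := xs (@lshift 3 5 k); rewrite usq_eval wrank_y /s_ex.
    case: eqP => [/(congr1 val) /= E|_ /eqP]; first by have := ltn_ord k; rewrite E.
    by rewrite expf_eq0 /= => /eqP xk; rewrite /yvec !mxE.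
  have := xs (widx (lift ord_max k)); rewrite usq_eval widxK /s_ex.
  rewrite webmx_coords ex_qform y0 mulr0 mul0r add0r.
  have -> : (widx (lift ord_max k) == ord_max) = false.
    by apply/eqP => E; have := widxK (lift ord_max k); rewrite E wrank_last.
  move/eqP; rewrite expf_eq0 /=; have -> : lift ord_max (lift ord_max k) = @lshift 3 2 k.
    apply/eqP; rewrite -val_eqE /= /bump [(4 <= _)%N]leqNgt [(3 <= _)%N]leqNgt ltn_ord.
    by rewrite (ltn_trans (ltn_ord k)).
  by move/eqP.
have := xs ord_max; rewrite usq_eval wrank_last /s_ex eqxx => x1.
apply: contra_eq_neq x1 => /eqP; rewrite /w5 /wvec !mxE => w0.
rewrite (_ : ord_max = @rshift 3 5 (@rshift 3 2 1)); last exact: val_inj.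
by rewrite (eqP w0) expr0n eq_sym oner_eq0.
Qed.

Theorem std_generic : exists F : R,
  (exists e, F.@[ex_web e] != 0) /\
  forall A S, (forall k, (S k)^T = S k) -> F.@[coords (stdweb A S)] != 0 ->
    birational_BS_Z (stdweb A S).
Proof.
have [U UE] := universal_ufun.
have [B HB] := generic_fibre U s_ex usq_size.
(* [B] is obtained before [e], so [e] may be chosen to suit it. *)
have [e e0 eH] := ex_web_Hmx B.
have [|F F0 FP] := HB (ex_web e) eH.
  by move=> x xs; rewrite UE; apply: ex_fibre.
have fa := polyfun_funalg C NPar.
have Pc i : polyfun (fun c : 'I_NPar -> C => c i) by apply: polyfun_coord.
have PA k : fa_mx (@polyfun C NPar) (fun c => webA c k) by apply: fa_webA.
have PS k : fa_mx (@polyfun C NPar) (fun c => webS c k) by apply: fa_webS.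
pose D c := \det (Ql (webA c) (webS c) lam3).
have PD : polyfun D by apply: (fa_detQl fa PA PS (fa_mx_cst fa lam3)).
have fad := dcfun_funalg fa PD.
pose v (cs : ('I_NPar -> C) * C) := vfun (webA cs.1) (webS cs.1) lam3 cs.2.
have Pv : dcfun (@polyfun C NPar) D v.
  have PA' k : fa_mx (dcfun (@polyfun C NPar) D) (fun cs => webA cs.1 k).
    by move=> i j; apply: (dcfun_base fa D (PA k i j)).
  have PS' k : fa_mx (dcfun (@polyfun C NPar) D) (fun cs => webS cs.1 k).
    by move=> i j; apply: (dcfun_base fa D (PS k i j)).
  exact: (fa_vfun fad PA' PS' (fa_mx_cst fad lam3) (dcfun_sqrt fa D)).
have [N PN NP] := dcfun_norm fa PD Pv.
have [G GE] : polyfun (fun c => N c * D c) by apply: (fa_mul fa).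
(* [F] governs density on the base locus; [G] makes [lam3] a good point for the double cover. *)
exists (F * G); split.
  exists e; rewrite mevalM GE !mulf_neq0 //.
    by apply/NP => s _; rewrite /v webA_std webS_std; apply: ex_vfun.
  by rewrite /D webA_std webS_std; apply: ex_det.
move=> A S Ssym; set c := coords _.
rewrite mevalM GE !mulf_eq0 !negb_or => /andP[/FP[Hd uF] /andP[/NP Nc Dc]].
have [AE SE] : webA c = A /\ webS c = S by rewrite webA_std webS_std.
apply: (@birational_std A S Ssym lam3); last first.
  split; first by move: Dc; rewrite /D AE SE.
  by move=> s sD; rewrite -AE -SE; apply: Nc; rewrite /D AE SE.
move=> p pu x xb.
have base m : (mdeg m <= 8.+1)%N -> exists2 h, (msize h <= (mdeg m).+1)%N &
    Psi (fun i => sp c (usq i)) h = 'X_[m].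
  by apply: Hmx_base => //; apply: usq_size.
have bsE y : (forall k, qform (stdweb A S k) y = 0) <->
    (forall i, wrank i -> (sp c (usq i)).@[y] = 0).
  split=> [yb i|yb k].
    by rewrite usq_eval; case: (wrank i) => // k _; rewrite webmx_coords.
  by have := yb (widx k); rewrite usq_eval widxK webmx_coords; apply.
(* Only the four web quadrics are held at zero; the four added squares vary freely. *)
apply: (@common_zeros_dense _ _ _ base (fun i => wrank i) (sp c U) s_ex).
- by move=> i wi; rewrite /s_ex; case: eqP => // il; move: wi; rewrite il wrank_last.
- exact: uF.
- by move=> y /bsE yb; rewrite UE AE SE; apply: pu.
- exact/bsE.
Qed.

End Universal.

(** * Change of coordinates *)

Definition linact n (g : 'M[C]_n) (x : 'I_n -> C) : 'I_n -> C :=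
  fun i => ((\row_j x j) *m g) 0 i.

Lemma row_linact n (g : 'M[C]_n) x : \row_i linact g x i = (\row_j x j) *m g.
Proof. by apply/rowP => i; rewrite mxE. Qed.

Lemma linactM n (g h : 'M[C]_n) x : linact h (linact g x) = linact (g *m h) x.
Proof.
by apply: functional_extensionality => i; rewrite /linact row_linact mulmxA.
Qed.

Lemma linact1 n (x : 'I_n -> C) : linact 1%:M x = x.
Proof. by apply: functional_extensionality => i; rewrite /linact mulmx1 mxE. Qed.

Lemma linactZ n (g : 'M[C]_n) c x : linact g (fun i => c * x i) = fun i => c * linact g x i.
Proof.
apply: functional_extensionality => i; rewrite /linact.
have -> : \row_j (c * x j) = c *: \row_j x j by apply/rowP => j; rewrite !mxE.
by rewrite -scalemxAl mxE.
Qed.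

Lemma qform_linact g Q x : qform (g *m Q *m g^T) x = qform Q (linact g x).
Proof. by rewrite /qform row_linact trmx_mul !mulmxA. Qed.

Lemma nonzero_linact g x : g \in unitmx -> nonzero_pt x -> nonzero_pt (linact g x : 'I_8 -> C).
Proof.
move=> ug [i xi]; apply/existsP; apply: contraNT xi.
rewrite negb_exists => /forallP gx.
have g0 : linact g x = fun=> 0.
  by apply: functional_extensionality => j; apply/eqP/negPn/gx.
rewrite -[x]linact1 -(mulmxV ug) -linactM g0 /linact.
have -> : \row_(_ < 8) 0 = 0 :> 'rV[C]_8 by apply/rowP => j; rewrite !mxE.
by rewrite mul0mx mxE.
Qed.

Lemma whomog_eval n (w : 'I_n -> nat) e (p : {mpoly C[n]}) t (x : 'I_n -> C) :
  whomog w e p -> p.@[fun i => t ^+ w i * x i] = t ^+ e * p.@[x].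
Proof.
move=> hp; rewrite !mevalE mulr_sumr; apply: eq_big_seq => m /hp <-.
rewrite mulrCA; congr (_ * _); rewrite -prodrXr -big_split.
by apply: eq_bigr => i _; rewrite exprMn -exprM.
Qed.

Lemma polyfun_linact n (g : 'M[C]_n) i : polyfun (fun x => linact g x i).
Proof.
have fa := polyfun_funalg C n.
apply: (@fa_ext _ _ _ fa (fun x => \sum_j x j * g j i)).
  by apply: (fa_sum fa) => j; apply: (fa_mul fa); [apply: polyfun_coord | apply: (fa_cst fa)].
by move=> x; rewrite /linact mxE; apply: eq_bigr => j _; rewrite mxE.
Qed.

Section Transport.
Variables (g : 'M[C]_8) (Qs : 'I_4 -> 'M[C]_8).
Hypothesis detg : \det g = 1.

Definition congweb (k : 'I_4) : 'M[C]_8 := g *m Qs k *m g^T.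

Let ug : g \in unitmx. Proof. by rewrite unitmxE detg unitr1. Qed.
Let uV : invmx g \in unitmx. Proof. by rewrite unitmx_inv. Qed.

Lemma base_congweb x : base_locus congweb x <-> base_locus Qs (linact g x).
Proof.
split=> -[x0 xq]; split.
- exact: nonzero_linact.
- by move=> k; rewrite -qform_linact; apply: xq.
- rewrite -[x]linact1 -(mulmxV ug) -linactM; exact: nonzero_linact.
- by move=> k; rewrite /congweb qform_linact.
Qed.

Lemma base_congweb_inv x : base_locus Qs x <-> base_locus congweb (linact (invmx g) x).
Proof. by rewrite base_congweb linactM mulVmx // linact1. Qed.

(** Congruence by a matrix of determinant 1 leaves [\det Q_l] unchanged, so the two covers have the
    same equation. *)
Lemma double_cover_congweb z : double_cover congweb z <-> double_cover Qs z.
Proof.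
rewrite /double_cover.
have -> : web_member congweb (lam z) = g *m web_member Qs (lam z) *m g^T.
  rewrite /web_member mulmx_sumr mulmx_suml; apply: eq_bigr => k _.
  by rewrite -scalemxAr -scalemxAl.
by rewrite !det_mulmx det_tr detg mul1r mulr1.
Qed.

(** The first map is precomposed with [invmx g] and the second followed by [g]; being linear, these
    leave all degrees unchanged. *)
Lemma birational_congweb : birational_BS_Z congweb -> birational_BS_Z Qs.
Proof.
move=> [d [e [du [dv [f [h [u [v [[hf hh] [hu hv] [Du Dv] phi psi]]]]]]]]].
have fa8 := polyfun_funalg C 8; have fa5 := polyfun_funalg C 5.
have pull (p : {mpoly C[8]}) : exists q : {mpoly C[8]},
    forall x, q.@[x] = p.@[linact (invmx g) x].
  by apply: (fa_meval fa8) => i; apply: polyfun_linact.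
have /fin_all_exists[f' fE] j := pull (f j).
have [u' uE] := pull u.
have /fin_all_exists[h' hE] i : exists q : {mpoly C[5]},
    forall z, q.@[z] = linact g (fun i => (h i).@[z]) i.
  have [q qE] := polyfun_linact g i.
  have : polyfun (fun z : 'I_5 -> C => q.@[fun i => (h i).@[z]]).
    by apply: (fa_meval fa5) => k; exists (h k).
  by case=> r rE; exists r => z; rewrite rE qE.
have lscale t x : linact (invmx g) (fun i => t ^+ 1 * x i) =
    fun i => t ^+ 1 * linact (invmx g) x i by rewrite linactZ.
exists d, e, du, dv, f', h', u', v; split.
- split=> [j|i]; apply: whomog_scaling => t x.
    by rewrite !fE lscale; apply: whomog_eval.
  rewrite !hE -[RHS]/((fun i => t ^+ e * linact g (fun i => (h i).@[x]) i) i) -linactZ.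
  by congr (linact g _ i); apply: functional_extensionality => k; apply: whomog_eval.
- split=> //; apply: whomog_scaling => t x.
  by rewrite !uE lscale; apply: whomog_eval.
- split.
    move=> p pu x /base_congweb_inv xb.
    have [q qE] : polyfun (fun x => p.@[linact g x]).
      by apply: (fa_meval fa8) => i; apply: polyfun_linact.
    have := Du q _ _ xb; rewrite qE linactM mulVmx // linact1; apply=> y yb uy.
    rewrite qE; apply: pu; first exact/base_congweb.
    by rewrite uE linactM mulmxV // linact1.
  move=> p pv z /double_cover_congweb zc; apply: Dv zc => y /double_cover_congweb yc.
  exact: pv.
- move=> x /base_congweb_inv xb; rewrite uE => ux /=.
  have -> : (fun j => (f' j).@[x]) = (fun j => (f j).@[linact (invmx g) x]).
    by apply: functional_extensionality => j; rewrite fE.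
  have [/double_cover_congweb zc vz [c c0 cE]] := phi _ xb ux.
  split=> //; exists c => // i; rewrite hE.
  have -> : (fun i => (h i).@[fun j => (f j).@[linact (invmx g) x]]) =
            (fun i => c * linact (invmx g) x i).
    by apply: functional_extensionality => k; rewrite cE.
  by rewrite linactZ linactM mulVmx // linact1.
move=> z /double_cover_congweb zc vz /=.
have -> : (fun i => (h' i).@[z]) = linact g (fun i => (h i).@[z]).
  by apply: functional_extensionality => i; rewrite hE.
have [/base_congweb xb ux [t t0 tE]] := psi _ zc vz.
split=> //; first by rewrite uE linactM mulmxV // linact1.
by exists t => // j; rewrite fE linactM mulmxV // linact1 tE.
Qed.

End Transport.

(** * Moving an arbitrary plane to standard position *)

Lemma plane_frame (B : 'M[C]_(3, 8)) : \rank B = 3%N -> exists g : 'M[C]_8,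
  [/\ \det g = 1, (usubmx (g : 'M_(3 + 5, 8)) <= B)%MS & (B <= usubmx (g : 'M_(3 + 5, 8)))%MS].
Proof.
move=> rB; pose g0 := row_ebase B.
have ug0 : g0 \in unitmx by apply: row_ebase_unit.
(* An eighth root rescales the [8 x 8] matrix [g0] to determinant 1. *)
have [t tE] : exists t : C, t ^+ 8 = (\det g0)^-1.
  have /closed_rootP[t] : size ('X^8 - ((\det g0)^-1)%:P : {poly C}) != 1%N.
    by rewrite size_XnsubC.
  by rewrite rootE !hornerE subr_eq0 => /eqP; exists t.
have d0 : \det g0 != 0 by rewrite -unitfE -unitmxE.
have t0 : t != 0.
  by apply: contraNneq d0 => t0; rewrite -invr_eq0 -tE t0 expr0n.
have BE : B = col_ebase B *m usubmx (g0 : 'M_(3 + 5, 8)).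
  rewrite -{1}(mulmx_ebase B) -mulmxA rB; congr (_ *m _).
  rewrite -/g0 -{1}(vsubmxK (g0 : 'M_(3 + 5, 8))).
  rewrite (_ : pid_mx 3 = row_mx 1%:M 0 :> 'M_(3, 3 + 5)).
    by rewrite (@mul_row_col _ 3 3 5 8) mul1mx mul0mx addr0.
  exact: pid_mx_row.
exists (t *: g0); rewrite detZ tE mulVf //.
have -> : usubmx (t *: g0 : 'M_(3 + 5, 8)) = t *: usubmx (g0 : 'M_(3 + 5, 8)).
  exact: linearZ.
split=> //.
  rewrite (eqmx_scale _ t0) -[usubmx _]mul1mx -(mulVmx (col_ebase_unit B)) -mulmxA -BE.
  exact: submxMl.
by rewrite (eqmx_scale _ t0) {1}BE submxMl.
Qed.

(** Polarization: the value at the sum of two basis vectors is [2 X i j] once the diagonal is known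
    to vanish. *)
Lemma sym_quad_eq0 n (X : 'M[C]_n) : X^T = X ->
  (forall y : 'rV_n, (y *m X *m y^T) 0 0 = 0) -> X = 0.
Proof.
move=> Xs Xq; apply/matrixP => i j; rewrite [RHS]mxE.
have dq a b : ((delta_mx 0 a : 'rV_n) *m X *m (delta_mx 0 b : 'rV_n)^T) 0 0 = X a b.
  by rewrite -rowE trmx_delta -colE !mxE.
have := Xq ((delta_mx 0 i : 'rV_n) + (delta_mx 0 j : 'rV_n)).
have mxD (M N : 'M[C]_1) : (M + N) 0 0 = M 0 0 + N 0 0 by rewrite mxE.
rewrite [_^T]linearD /= mulmxDl !mulmxDr !mulmxDl !mxD !dq.
have -> : X j i = X i j by rewrite -{1}Xs mxE.
have Xd a : X a a = 0 by rewrite -dq Xq.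
rewrite !Xd add0r addr0 => /eqP; rewrite -mulr2n -mulr_natl mulf_eq0.
by rewrite (negbTE C_two_neq0) => /eqP.
Qed.

Lemma row_mx0_mul p q n (y : 'rV[C]_p) (g : 'M[C]_(p + q, n)) :
  row_mx y 0 *m g = y *m usubmx g.
Proof. by rewrite -{1}(vsubmxK g) mul_row_col mul0mx addr0. Qed.

Lemma ulsubmx_quad p q (X : 'M[C]_(p + q)) (y : 'rV[C]_p) :
  y *m ulsubmx X *m y^T = row_mx y 0 *m X *m (row_mx y 0)^T.
Proof.
rewrite -{2}[X]submxK mul_row_block !mul0mx !addr0 tr_row_mx trmx0 mul_row_col.
by rewrite mulmx0 addr0.
Qed.

Lemma qform_row Q (r : 'rV[C]_8) : qform Q (fun i => r 0 i) = (r *m Q *m r^T) 0 0.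
Proof.
by rewrite /qform; have -> : \row_i r 0 i = r by apply/rowP => i; rewrite mxE.
Qed.

Lemma congweb_std (B : 'M[C]_(3, 8)) (g : 'M[C]_8) Qs :
  (usubmx (g : 'M_(3 + 5, 8)) <= B)%MS -> quadrics_through_plane B Qs ->
  exists A S, (forall k, (S k)^T = S k) /\ congweb g Qs = stdweb A S.
Proof.
move=> gB QB; pose X k : 'M[C]_(3 + 5) := congweb g Qs k.
have Xs k : (X k)^T = X k.
  have [Qsym _] := QB k; rewrite /Defs.symmetricmx in Qsym.
  by rewrite /X /congweb !trmx_mul trmxK Qsym mulmxA.
have ul0 k : ulsubmx (X k) = 0.
  apply: sym_quad_eq0; first by rewrite trmx_ulsub Xs.
  move=> y; have [_ Q0] := QB k.
  rewrite ulsubmx_quad; pose r := y *m usubmx (g : 'M_(3 + 5, 8)).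
  have := Q0 (fun i => r 0 i); rewrite qform_row.
  have -> : \row_i r 0 i = r by apply/rowP => i; rewrite mxE.
  move=> /(_ (submx_trans (submxMl _ _) gB)) <-; congr (_ _ _).
  rewrite /r -(row_mx0_mul y (g : 'M_(3 + 5, 8))) /X /congweb trmx_mul.
  by rewrite !mulmxA.
exists (fun k => ursubmx (X k)), (fun k => drsubmx (X k)); split=> [k|].
  by rewrite trmx_drsub Xs.
apply: functional_extensionality => k; rewrite /stdweb.
by rewrite -{1}[congweb g Qs k](@submxK _ 3 5 3 5) -/(X k) ul0 trmx_ursub Xs.
Qed.

(** Turns the example into a web through the given plane, which shows that the open set is
    nonempty. *)
Lemma stdweb_through (B : 'M[C]_(3, 8)) (g : 'M[C]_8) A S :
  g \in unitmx -> (B <= usubmx (g : 'M_(3 + 5, 8)))%MS -> (forall k, (S k)^T = S k) ->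
  quadrics_through_plane B (congweb (invmx g) (stdweb A S)).
Proof.
move=> ug Bg Ssym k; split.
  rewrite /Defs.symmetricmx /congweb !trmx_mul trmxK mulmxA; congr (_ *m _ *m _).
  by rewrite /stdweb (@tr_block_mx _ 3 5 3 5) trmx0 trmxK Ssym.
move=> x xB; rewrite /congweb qform_linact /qform row_linact.
have /submxP[y ->] := submx_trans xB Bg.
rewrite -(row_mx0_mul y (g : 'M_(3 + 5, 8))) mulmxK //.
rewrite /stdweb -(@ulsubmx_quad 3 5 (block_mx 0 (A k) (A k)^T (S k)) y).
by rewrite block_mxKul mulmx0 mul0mx mxE.
Qed.

Theorem mainTheorem1 :
  forall B : 'M[C]_(3, 8), \rank B = 3%N ->
  exists F : {mpoly C[NPar]},
    (exists Qs : 'I_4 -> 'M[C]_8,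
        quadrics_through_plane B Qs /\ F.@[coords Qs] != 0) /\
    (forall Qs : 'I_4 -> 'M[C]_8,
        quadrics_through_plane B Qs -> lin_indep4 Qs ->
        F.@[coords Qs] != 0 -> birational_BS_Z Qs).
Proof.
move=> B /plane_frame[g [detg gB Bg]].
have ug : g \in unitmx by rewrite unitmxE detg unitr1.
have [G [[e Ge] GP]] := std_generic.
have fa := polyfun_funalg C NPar.
(* The open condition for the standard plane, pulled back along the congruence by [g], which is
   linear in the entries of the web. *)
have [F FE] : polyfun (fun c => G.@[coords (congweb g (webmx c))]).
  apply: (fa_meval fa) => i; rewrite /coords; case: (enum_val i) => [[k a] b].
  have Pw : fa_mx (@polyfun C NPar) (fun c => webmx c k).
    by apply: (fa_webmx fa) => j; apply: polyfun_coord.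
  exact: (fa_mxM fa (fa_mxM fa (fa_mx_cst fa g) Pw) (fa_mx_cst fa g^T)).
exists F; split.
  exists (congweb (invmx g) (stdweb (exA e) (exS e))); split.
    by apply: stdweb_through => //; apply: exS_sym.
  rewrite FE webmx_coords.
  have -> : congweb g (congweb (invmx g) (stdweb (exA e) (exS e))) = stdweb (exA e) (exS e).
    apply: functional_extensionality => k; rewrite /congweb !mulmxA mulmxV // mul1mx.
    by rewrite -mulmxA -trmx_mul mulmxV // trmx1 mulmx1.
  exact: Ge.
move=> Qs QB _; rewrite FE webmx_coords => FQ; apply: (birational_congweb detg).
have [A [S [Ssym E]]] := congweb_std gB QB.
by move: FQ; rewrite E => /GP; apply.
Qed.
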